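(* Let $n=k+l$ with $0\le l\le n/2$. The mapping $$\varphi: B(u)\mapsto T(u)\,G\,T^{-1}(-u)$$ defines an embedding (an injective algebra homomorphism) of the reflection algebra $\mathcal B(n,l)$ into the Yangian $\mathrm Y(n)$.
   Context: Yangian. $\mathrm Y(n)$ is the unital associative $\mathbb C$-algebra with generators $t_{ij}^{(r)}$, $r\ge 1$, $1\le i,j\le n$, and defining relations $$[t_{ij}(u),t_{rs}(v)]=\frac1{u-v}\big(t_{rj}(u)t_{is}(v)-t_{rj}(v)t_{is}(u)\big),\qquad t_{ij}(u)=\delta_{ij}+\sum_{r\ge1}t_{ij}^{(r)}u^{-r}.$$ $T(u)=\sum_{i,j}t_{ij}(u)\otimes E_{ij}\in\mathrm Y(n)[[u^{-1}]]\otimes\mathrm{End}\,\mathbb C^n$ ($E_{ij}$ the matrix units), and $T^{-1}(u)$ is its inverse matrix. Reflection algebra. Let $n=k+l$ with $k,l\ge0$ integers, $\varepsilon_i=1$ for $1\le i\le k$, $\varepsilon_i=-1$ for $k+1\le i\le n$, $G=\mathrm{diag}(\varepsilon_1,\dots,\varepsilon_n)$. $\mathcal B(n,l)$ is the unital associative $\mathbb C$-algebra with generators $b_{ij}^{(r)}$, $r\ge 1$, $1\le i,j\le n$. Put $b_{ij}(u)=\sum_{r\ge 0} b_{ij}^{(r)}u^{-r}$ with $b_{ij}^{(0)}=\delta_{ij}\varepsilon_i$, and $B(u)=\sum_{i,j} b_{ij}(u)\otimes E_{ij}$. The defining relations are the reflection equation $$R(u-v)B_1(u)R(u+v)B_2(v)=B_2(v)R(u+v)B_1(u)R(u-v)$$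 and the unitary condition $B(u)B(-u)=1$. Here $R(u)=1-Pu^{-1}$, $P=\sum_{i,j}E_{ij}\otimes E_{ji}$, the subscripts $1,2$ show in which copy of $\mathrm{End}\,\mathbb C^n$ the matrix lies, and the relation is understood coefficientwise after multiplying by $u^2-v^2$. The map $\varphi$ is understood entrywise: $b_{ij}^{(r)}$ is sent to the coefficient of $u^{-r}$ in the $(i,j)$ entry of $T(u)GT^{-1}(-u)$. *)

(* Defs.v *)
From HB Require Import structures.
From mathcomp Require Import all_boot all_order all_algebra.
From mathcomp Require Import boolp classical_sets reals.
From mathcomp Require Import generic_quotient ring_quotient mxtens complex.
From mathcomp Require Import monalg ring.

Set Implicit Arguments.
Unset Strict Implicit.
Unset Printing Implicit Defensive.

Import GRing.Theory.
Local Open Scope ring_scope.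

(* Formal power series R[[x]] over a ring that need not be commutative.
   Throughout, the variable x is the inverse u^-1 of a spectral parameter, so
   that f r is the coefficient of u^-r in f. *)
Record fps (R : Type) := Fps { fps_coef :> nat -> R }.

HB.instance Definition _ (R : Type) := [isNew for @fps_coef R].
HB.instance Definition _ (R : choiceType) := [Choice of fps R by <:].

Lemma fpsP (R : Type) (f g : fps R) : f = g <-> (forall r, f r = g r).
Proof.
split=> [-> //|]; case: f g => [f] [g] /= fg.
by congr Fps; apply: funext.
Qed.

Section FpsZmodule.
Variable R : zmodType.
Implicit Types f g : fps R.

Definition fps_zero : fps R := Fps (fun=> 0).
Definition fps_opp f : fps R := Fps (fun r => - f r).
Definition fps_add f g : fps R := Fps (fun r => f r + g r).

Fact fps_addA : associative fps_add.
Proof. by move=> f g h; apply/fpsP => r /=; rewrite addrA. Qed.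
Fact fps_addC : commutative fps_add.
Proof. by move=> f g; apply/fpsP => r /=; rewrite addrC. Qed.
Fact fps_add0 : left_id fps_zero fps_add.
Proof. by move=> f; apply/fpsP => r /=; rewrite add0r. Qed.
Fact fps_addN : left_inverse fps_zero fps_opp fps_add.
Proof. by move=> f; apply/fpsP => r /=; rewrite addNr. Qed.

HB.instance Definition _ :=
  GRing.isZmodule.Build (fps R) fps_addA fps_addC fps_add0 fps_addN.

Definition fps_const (a : R) : fps R := Fps (fun r => if r is 0 then a else 0).

(* f(u) |-> f(-u) *)
Definition fps_neg f : fps R := Fps (fun r => if odd r then - f r else f r).

End FpsZmodule.

Section FpsRing.
Variable R : pzRingType.
Implicit Types f g h : fps R.

Definition fps_mul f g : fps R :=
  Fps (fun r => \sum_(k < r.+1) f k * g (r - k)%N).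

Lemma fps_mul_rev f g r :
  fps_mul f g r = \sum_(k < r.+1) f (r - k)%N * g k.
Proof.
rewrite /= (reindex_inj rev_ord_inj) /=.
by apply: eq_bigr => j _; rewrite (sub_ordK j).
Qed.

Fact fps_mulA : associative fps_mul.
Proof.
move=> p q r; apply/fpsP => i; rewrite [RHS]fps_mul_rev /=.
pose coef3 j k := p j * (q (i - j - k)%N * r k).
transitivity (\sum_(j < i.+1) \sum_(k < i.+1 | (k <= i - j)%N) coef3 j k).
  apply: eq_bigr => /= j _; rewrite [X in _ * X]fps_mul_rev big_distrr /=.
  by rewrite (big_ord_narrow_leq (leq_subr _ _)).
rewrite (exchange_big_dep predT) //=; apply: eq_bigr => k _.
transitivity (\sum_(j < i.+1 | (j <= i - k)%N) coef3 j k).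
  apply: eq_bigl => j; rewrite -ltnS -(ltnS j) -!subSn ?leq_ord //.
  by rewrite -subn_gt0 -(subn_gt0 j) -!subnDA addnC.
rewrite (big_ord_narrow_leq (leq_subr _ _)) big_distrl /=.
by apply: eq_bigr => j _; rewrite /coef3 -!subnDA addnC mulrA.
Qed.

Fact fps_mul1 : left_id (fps_const 1) fps_mul.
Proof.
move=> f; apply/fpsP => r /=.
by rewrite big_ord_recl subn0 mul1r big1 ?addr0 // => k _; rewrite mul0r.
Qed.

Fact fps_mulr1 : right_id (fps_const 1) fps_mul.
Proof.
move=> f; apply/fpsP => r; rewrite fps_mul_rev /=.
by rewrite big_ord_recl subn0 mulr1 big1 ?addr0 // => k _; rewrite mulr0.
Qed.

Fact fps_mulDl : left_distributive fps_mul +%R.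
Proof.
move=> f g h; apply/fpsP => r /=; rewrite -big_split /=.
by apply: eq_bigr => k _; rewrite mulrDl.
Qed.

Fact fps_mulDr : right_distributive fps_mul +%R.
Proof.
move=> f g h; apply/fpsP => r /=; rewrite -big_split /=.
by apply: eq_bigr => k _; rewrite mulrDr.
Qed.

HB.instance Definition _ := GRing.Zmodule_isPzRing.Build (fps R)
  fps_mulA fps_mul1 fps_mulr1 fps_mulDl fps_mulDr.

Definition fps_X : fps R := Fps (fun r => (r == 1)%:R).

(* The inverse of a series with constant term 1, as the geometric series
   \sum_k (1 - f)^k, of which only the terms k <= r contribute in degree r. *)
Definition fps_inv f : fps R :=
  Fps (fun r => \sum_(k < r.+1) ((1 - f) ^+ k) r).

Lemma fps0E r : (0 : fps R) r = 0. Proof. by []. Qed.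
Lemma fpsNE f r : (- f) r = - f r. Proof. by []. Qed.
Lemma fpsDE f g r : (f + g) r = f r + g r. Proof. by []. Qed.
Lemma fps1E r : (1 : fps R) r = (r == 0)%:R. Proof. by case: r. Qed.
Lemma fpsME f g r : (f * g) r = \sum_(k < r.+1) f k * g (r - k)%N.
Proof. by []. Qed.
Definition fpsE := (fps0E, fpsNE, fpsDE, fps1E, fpsME).

Lemma fps_sumE I (s : seq I) (P : pred I) (F : I -> fps R) r :
  (\sum_(i <- s | P i) F i) r = \sum_(i <- s | P i) F i r.
Proof. exact: (big_morph (fun g : fps R => g r) (fun _ _ => erefl) erefl). Qed.

Fact fps_const_is_zmod_morphism : zmod_morphism (@fps_const R).
Proof.
by move=> a b; apply/fpsP => -[|r]; rewrite fpsDE fpsNE /= ?subr0.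
Qed.

Fact fps_const_is_monoid_morphism : monoid_morphism (@fps_const R).
Proof.
split=> // a b; apply/fpsP => r; rewrite fpsME big_ord_recl /= subn0.
rewrite big1 ?addr0 => [|k _]; last by rewrite mul0r.
by case: r => [|r] //=; rewrite mulr0.
Qed.

HB.instance Definition _ := GRing.isZmodMorphism.Build R (fps R)
  (@fps_const R) fps_const_is_zmod_morphism.
HB.instance Definition _ := GRing.isMonoidMorphism.Build R (fps R)
  (@fps_const R) fps_const_is_monoid_morphism.

Lemma fps_commX f : fps_X * f = f * fps_X.
Proof.
apply/fpsP => r; rewrite fps_mul_rev fpsME.
by apply: eq_bigr => k _; rewrite /=; case: eqP; rewrite !(mulr0, mul0r, mulr1, mul1r).
Qed.

Lemma fps_exp_eq0 f k r : f 0 = 0 -> (r < k)%N -> (f ^+ k) r = 0.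
Proof.
move=> f0; elim: k r => [//|k IHk] r; rewrite ltnS => le_rk.
rewrite exprS fpsE big_ord_recl f0 mul0r add0r big1 // => i _.
rewrite IHk ?mulr0 //= /bump add1n.
case: r i le_rk => [[]//|r] i le_rk.
by rewrite subSS (leq_ltn_trans _ le_rk) ?leq_subr.
Qed.

Lemma fps_invE f N r : f 0 = 1 -> (r < N)%N ->
  fps_inv f r = (\sum_(k < N) (1 - f) ^+ k) r.
Proof.
move=> f0 ltrN; rewrite fps_sumE /= -(subnKC ltrN) big_split_ord /=.
rewrite [X in _ = _ + X]big1 ?addr0 // => k _.
by rewrite fps_exp_eq0 ?leq_addr // !fpsE f0 subrr.
Qed.

Lemma fps_inv_comm f : f 0 = 1 -> f * fps_inv f = 1 /\ fps_inv f * f = 1.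
Proof.
move=> f0; pose S N : fps R := \sum_(k < N) (1 - f) ^+ k.
have f10 : (1 - f) 0 = 0 by rewrite !fpsE f0 subrr.
have fS N : (1 - (1 - f)) * S N = 1 - (1 - f) ^+ N.
  by rewrite -opprB mulNr -subrX1 opprB.
have comS N : S N * (1 - (1 - f)) = (1 - (1 - f)) * S N.
  rewrite /S mulr_suml mulr_sumr; apply: eq_bigr => k _.
  by rewrite mulrBl mulrBr mulr1 mul1r -exprSr exprS.
have subf : 1 - (1 - f) = f by rewrite opprB addrC subrK.
have trunc N r : (r < N)%N -> (1 - (1 - f) ^+ N) r = (1 : fps R) r.
  by move=> ltrN; rewrite fpsDE fpsNE fps_exp_eq0 // subr0.
rewrite -{1 4}subf; split; apply/fpsP => r.
- rewrite -(trunc r.+1) // -fS !fpsME; apply: eq_bigr => k _.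
  by rewrite (@fps_invE _ r.+1) // ltnS leq_subr.
- rewrite -(trunc r.+1) // -fS -comS !fpsME; apply: eq_bigr => k _.
  by rewrite (@fps_invE _ r.+1).
Qed.

End FpsRing.

Definition fps_map (R S : Type) (f : R -> S) (g : fps R) : fps S :=
  Fps (fun r => f (g r)).

Section FpsMap.
Variables (R S : pzRingType) (f : {rmorphism R -> S}).

Fact fps_map_is_zmod_morphism : zmod_morphism (fps_map f).
Proof. by move=> g h; apply/fpsP => r; rewrite /= rmorphB. Qed.

Fact fps_map_is_monoid_morphism : monoid_morphism (fps_map f).
Proof.
split=> [|g h]; apply/fpsP => r.
  by case: r => [|r] /=; rewrite ?rmorph1 ?rmorph0.
by rewrite /= rmorph_sum; apply: eq_bigr => k _; rewrite rmorphM.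
Qed.

HB.instance Definition _ := GRing.isZmodMorphism.Build (fps R) (fps S)
  (fps_map f) fps_map_is_zmod_morphism.
HB.instance Definition _ := GRing.isMonoidMorphism.Build (fps R) (fps S)
  (fps_map f) fps_map_is_monoid_morphism.

End FpsMap.

(* Series in u^-1 and v^-1 are elements F of fps (fps R), where F p q is the
   coefficient of u^-p v^-q. *)
Section TwoVariables.
Variable R : pzRingType.

Definition ser_u (f : fps R) : fps (fps R) := fps_map (@fps_const R) f.
Definition ser_v (f : fps R) : fps (fps R) := fps_const f.
Definition ser_c (a : R) : fps (fps R) := fps_const (fps_const a).

Definition u_inv : fps (fps R) := ser_u (fps_X R).
Definition v_inv : fps (fps R) := ser_v (fps_X R).

End TwoVariables.

Section FreeAlgebra.
Variables (K : comNzRingType) (X : choiceType).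

Definition freeAlg := {malg K[{fmonom X}]}.

HB.instance Definition _ := GRing.Lalgebra.on freeAlg.

Fact freeAlg_scaleAr (c : K) (x y : freeAlg) : c *: (x * y) = x * (c *: y).
Proof.
have comC z : (c%:MP : freeAlg) * z = z * c%:MP.
  rewrite !malgM_def fgmulUg fgmulgU; apply: eq_bigr => m _.
  by rewrite mulrC mul1m mulm1.
by rewrite -[LHS]mul_malgC -[c *: y]mul_malgC mulrA comC -mulrA.
Qed.

HB.instance Definition _ := GRing.Lalgebra_isAlgebra.Build K freeAlg
  freeAlg_scaleAr.

Definition freeAlg_gen (x : X) : freeAlg := mkmalgU (fmu x) 1.

(* The character of the free algebra that kills every generator. *)
Definition freeAlg_counit : {rmorphism {malg K[{fmonom X}]} -> K} :=
  mcoeff (mone : {fmonom X}).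

Lemma freeAlg_counit_gen x : freeAlg_counit (freeAlg_gen x) = 0.
Proof.
rewrite /freeAlg_counit /= mcoeffU; case: eqP => // /(congr1 val) /=.
by rewrite fm1 fmuE.
Qed.

Lemma freeAlg_counitZ c x : freeAlg_counit (c *: x) = c * freeAlg_counit x.
Proof. exact: mcoeffZ. Qed.

End FreeAlgebra.

Section IdealQuotient.
Variables (K : comNzRingType) (A : algType K).

Inductive two_sided_ideal (S : set A) : A -> Prop :=
| ideal_gen x of S x : two_sided_ideal S x
| ideal_zero : two_sided_ideal S 0
| ideal_sub x y of two_sided_ideal S x & two_sided_ideal S y :
    two_sided_ideal S (x - y)
| ideal_mul a x b of two_sided_ideal S x : two_sided_ideal S (a * x * b).

Variable S : set A.

Definition ideal_pred : {pred A} := fun x => `[< two_sided_ideal S x >].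

Lemma ideal_predP x : reflect (two_sided_ideal S x) (x \in ideal_pred).
Proof. exact: asboolP. Qed.

Fact ideal_pred_zmod_closed : zmod_closed ideal_pred.
Proof.
split=> [|x y /ideal_predP Ix /ideal_predP Iy]; apply/ideal_predP.
  exact: ideal_zero.
exact: ideal_sub.
Qed.

HB.instance Definition _ :=
  GRing.isZmodClosed.Build A ideal_pred ideal_pred_zmod_closed.

Lemma ideal_predMl a x : x \in ideal_pred -> a * x \in ideal_pred.
Proof.
by move=> /ideal_predP Ix; apply/ideal_predP; rewrite -[a * x]mulr1; constructor.
Qed.

Lemma ideal_predMr x b : x \in ideal_pred -> x * b \in ideal_pred.
Proof.
by move=> /ideal_predP Ix; apply/ideal_predP; rewrite -[x]mul1r; constructor.
Qed.

(* The MathComp structure algType requires 1 != 0, hence the second argument. *)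
Definition quotAlg (_ : ~ two_sided_ideal S 1) := Quotient.quot ideal_pred.

Variable S_proper : ~ two_sided_ideal S 1.
Local Notation Q := (quotAlg S_proper).
Local Open Scope quotient_scope.

HB.instance Definition _ := GRing.Zmodule.on Q.

Definition quotAlg_pi (x : A) : Q := \pi_(Quotient.quot ideal_pred) x.

Lemma quotAlg_piP x y : quotAlg_pi x = quotAlg_pi y <-> two_sided_ideal S (x - y).
Proof.
split=> [/eqP|Ixy]; first by rewrite -Quotient.idealrBE => /ideal_predP.
by apply/eqP; rewrite -Quotient.idealrBE; apply/ideal_predP.
Qed.

Lemma quotAlg_repr (q : Q) : quotAlg_pi (repr q) = q.
Proof. exact: reprK. Qed.

Fact quotAlg_pi_is_zmod_morphism : zmod_morphism quotAlg_pi.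
Proof. by move=> x y; rewrite /quotAlg_pi; rewrite !piE. Qed.

HB.instance Definition _ := GRing.isZmodMorphism.Build A Q quotAlg_pi
  quotAlg_pi_is_zmod_morphism.

Definition quotAlg_mul (p q : Q) : Q := quotAlg_pi (repr p * repr q).
Definition quotAlg_scale (c : K) (q : Q) : Q := quotAlg_pi (c *: repr q).

Lemma quotAlg_piM x y :
  quotAlg_pi (x * y) = quotAlg_mul (quotAlg_pi x) (quotAlg_pi y).
Proof.
set x' := repr (quotAlg_pi x); set y' := repr (quotAlg_pi y).
have Ix : x - x' \in ideal_pred.
  by apply/ideal_predP/quotAlg_piP; rewrite quotAlg_repr.
have Iy : y - y' \in ideal_pred.
  by apply/ideal_predP/quotAlg_piP; rewrite quotAlg_repr.
apply/quotAlg_piP/ideal_predP.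
have -> : x * y - x' * y' = (x - x') * y + x' * (y - y').
  by rewrite mulrBl mulrBr addrA subrK.
by apply: rpredD; [apply: ideal_predMr | apply: ideal_predMl].
Qed.

Lemma quotAlg_piZ c x : quotAlg_pi (c *: x) = quotAlg_scale c (quotAlg_pi x).
Proof.
set x' := repr (quotAlg_pi x).
apply/quotAlg_piP/ideal_predP; rewrite -scalerBr -mulr_algl ideal_predMl //.
by apply/ideal_predP/quotAlg_piP; rewrite quotAlg_repr.
Qed.

Lemma quotAlg_ind (P : Q -> Prop) : (forall x, P (quotAlg_pi x)) -> forall q, P q.
Proof. by move=> Ppi q; rewrite -[q]quotAlg_repr. Qed.

Fact quotAlg_mulA : associative quotAlg_mul.
Proof.
elim/quotAlg_ind=> x; elim/quotAlg_ind=> y; elim/quotAlg_ind=> z.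
by rewrite -!quotAlg_piM mulrA.
Qed.
Fact quotAlg_mul1r : left_id (quotAlg_pi 1) quotAlg_mul.
Proof. by elim/quotAlg_ind=> x; rewrite -quotAlg_piM mul1r. Qed.
Fact quotAlg_mulr1 : right_id (quotAlg_pi 1) quotAlg_mul.
Proof. by elim/quotAlg_ind=> x; rewrite -quotAlg_piM mulr1. Qed.
Fact quotAlg_mulDl : left_distributive quotAlg_mul +%R.
Proof.
elim/quotAlg_ind=> x; elim/quotAlg_ind=> y; elim/quotAlg_ind=> z.
by rewrite -raddfD -!quotAlg_piM mulrDl raddfD.
Qed.
Fact quotAlg_mulDr : right_distributive quotAlg_mul +%R.
Proof.
elim/quotAlg_ind=> x; elim/quotAlg_ind=> y; elim/quotAlg_ind=> z.
by rewrite -raddfD -!quotAlg_piM mulrDr raddfD.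
Qed.

HB.instance Definition _ := GRing.Zmodule_isPzRing.Build Q
  quotAlg_mulA quotAlg_mul1r quotAlg_mulr1 quotAlg_mulDl quotAlg_mulDr.

Fact quotAlg_nonzero1 : (1 : Q) != 0.
Proof.
apply/eqP => Q10; apply: S_proper; rewrite -[1]subr0; apply/quotAlg_piP.
by rewrite raddf0.
Qed.

HB.instance Definition _ := GRing.PzSemiRing_isNonZero.Build Q quotAlg_nonzero1.

Fact quotAlg_pi_is_monoid_morphism : monoid_morphism quotAlg_pi.
Proof. by split=> // x y; apply: quotAlg_piM. Qed.

HB.instance Definition _ := GRing.isMonoidMorphism.Build A Q quotAlg_pi
  quotAlg_pi_is_monoid_morphism.

Fact quotAlg_scalerA a b q :
  quotAlg_scale a (quotAlg_scale b q) = quotAlg_scale (a * b) q.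
Proof. by elim/quotAlg_ind: q => x; rewrite -!quotAlg_piZ scalerA. Qed.
Fact quotAlg_scale1r : left_id 1 quotAlg_scale.
Proof. by elim/quotAlg_ind=> x; rewrite -quotAlg_piZ scale1r. Qed.
Fact quotAlg_scalerDr : right_distributive quotAlg_scale +%R.
Proof.
move=> c; elim/quotAlg_ind=> x; elim/quotAlg_ind=> y.
by rewrite -raddfD -!quotAlg_piZ scalerDr raddfD.
Qed.
Fact quotAlg_scalerDl q : {morph quotAlg_scale^~ q : a b / a + b}.
Proof.
by elim/quotAlg_ind: q => x a b; rewrite -!quotAlg_piZ scalerDl raddfD.
Qed.

HB.instance Definition _ := GRing.Zmodule_isLmodule.Build K Q
  quotAlg_scalerA quotAlg_scale1r quotAlg_scalerDr quotAlg_scalerDl.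

Fact quotAlg_scalerAl c (p q : Q) : c *: (p * q) = c *: p * q.
Proof.
elim/quotAlg_ind: p => x; elim/quotAlg_ind: q => y.
by rewrite -rmorphM -[c *: quotAlg_pi x]quotAlg_piZ
  -[LHS]quotAlg_piZ scalerAl rmorphM.
Qed.

HB.instance Definition _ := GRing.Lmodule_isLalgebra.Build K Q quotAlg_scalerAl.

Fact quotAlg_scalerAr c (p q : Q) : c *: (p * q) = p * (c *: q).
Proof.
elim/quotAlg_ind: p => x; elim/quotAlg_ind: q => y.
by rewrite -rmorphM -[c *: quotAlg_pi y]quotAlg_piZ
  -[LHS]quotAlg_piZ scalerAr rmorphM.
Qed.

HB.instance Definition _ := GRing.Lalgebra_isAlgebra.Build K Q quotAlg_scalerAr.

HB.instance Definition _ := GRing.isScalable.Build K A Q *:%R quotAlg_pi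
  quotAlg_piZ.

End IdealQuotient.

Lemma two_sided_ideal_ker (K : comNzRingType) (A : algType K) (R : pzRingType)
    (f : {rmorphism A -> R}) (S : set A) :
  (forall x, S x -> f x = 0) -> forall x, two_sided_ideal S x -> f x = 0.
Proof.
move=> fS x; elim=> {x} [x /fS //||x y _ fx _ fy|a x b _ fx].
- exact: rmorph0.
- by rewrite rmorphB fx fy subrr.
- by rewrite !rmorphM fx mulr0 mul0r.
Qed.

Lemma fps_mapE (R S : Type) (f : R -> S) (g : fps R) r : fps_map f g r = f (g r).
Proof. by []. Qed.

Lemma fps_map_const (R S : zmodType) (f : {additive R -> S}) a :
  fps_map f (fps_const a) = fps_const (f a).
Proof. by apply/fpsP => -[|r] //=; rewrite raddf0. Qed.

Section TwoVariablesMap.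
Variables (R S : pzRingType) (f : {rmorphism R -> S}).
Local Notation F := (fps_map (fps_map f)).

Lemma map_ser_u g : F (ser_u g) = ser_u (fps_map f g).
Proof. by apply/fpsP => p /=; rewrite fps_map_const. Qed.

Lemma map_ser_v g : F (ser_v g) = ser_v (fps_map f g).
Proof. by rewrite /ser_v fps_map_const. Qed.

Lemma map_ser_c a : F (ser_c a) = ser_c (f a).
Proof. by rewrite /ser_c !fps_map_const /= fps_map_const. Qed.

Lemma map_fps_X : fps_map f (fps_X R) = fps_X S.
Proof. by apply/fpsP => r /=; rewrite rmorph_nat. Qed.

Lemma map_u_inv : F (u_inv R) = u_inv S.
Proof. by rewrite /u_inv map_ser_u map_fps_X. Qed.

Lemma map_v_inv : F (v_inv R) = v_inv S.
Proof. by rewrite /v_inv map_ser_v map_fps_X. Qed.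

End TwoVariablesMap.

Section Relations.
Variables (A : pzRingType) (n : nat).

Definition mx_entry (T : fps 'M[A]_n) (i j : 'I_n) : fps A :=
  fps_map (fun M : 'M[A]_n => M i j) T.

(* u^-1 v^-1 times the difference of the two sides of
   (u - v) [t_ij(u), t_ab(v)] = t_aj(u) t_ib(v) - t_aj(v) t_ib(u),
   where u^-1 v^-1 (u - v) = v^-1 - u^-1. *)
Definition yangian_eqn (T : fps 'M[A]_n) (i j a b : 'I_n) : fps (fps A) :=
  let tu i j := ser_u (mx_entry T i j) in
  let tv i j := ser_v (mx_entry T i j) in
  (v_inv A - u_inv A) * (tu i j * tv a b - tv a b * tu i j)
  - u_inv A * v_inv A * (tu a j * tv i b - tv a j * tu i b).

(* \sum_(i, j) E_ij (x) E_ji *)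
Definition flip_mx : 'M[A]_(n * n) :=
  \sum_(i < n) \sum_(j < n) delta_mx i j *t delta_mx j i.

(* u^-1 v^-1 (u - v) R(u - v) and u^-1 v^-1 (u + v) R(u + v),
   where R(u) = 1 - P u^-1. *)
Definition R_sub : fps (fps 'M[A]_(n * n)) :=
  v_inv _ - u_inv _ - u_inv _ * v_inv _ * ser_c flip_mx.
Definition R_add : fps (fps 'M[A]_(n * n)) :=
  v_inv _ + u_inv _ - u_inv _ * v_inv _ * ser_c flip_mx.

Definition mx_in1 (M : 'M[A]_n) : 'M[A]_(n * n) := M *t 1%:M.
Definition mx_in2 (M : 'M[A]_n) : 'M[A]_(n * n) := 1%:M *t M.

(* The reflection equation multiplied by (u^2 - v^2) u^-2 v^-2. *)
Definition reflection_eqn (B : fps 'M[A]_n) : fps (fps 'M[A]_(n * n)) :=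
  let B1u := ser_u (fps_map mx_in1 B) in
  let B2v := ser_v (fps_map mx_in2 B) in
  R_sub * B1u * R_add * B2v - B2v * R_add * B1u * R_sub.

Definition unitarity_eqn (B : fps 'M[A]_n) : fps 'M[A]_n := B * fps_neg B - 1.

(* diag(1, ..., 1, -1, ..., -1) with l entries -1 *)
Definition sign_mx (l : nat) : 'M[A]_n :=
  diag_mx (\row_(i < n) if (i < n - l)%N then 1 else -1).

End Relations.

Section RelationsMap.
Variables (A A' : pzRingType) (f : {rmorphism A -> A'}) (n : nat).

Lemma map_mx_entry (T : fps 'M[A]_n) i j :
  fps_map f (mx_entry T i j) = mx_entry (fps_map (map_mx f) T) i j.
Proof. by apply/fpsP => r; rewrite /= mxE. Qed.

Lemma map_yangian_eqn (T : fps 'M[A]_n) i j a b :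
  fps_map (fps_map f) (yangian_eqn T i j a b)
    = yangian_eqn (fps_map (map_mx f) T) i j a b.
Proof.
by rewrite /yangian_eqn !(rmorphB, rmorphM) /=
  !(map_u_inv, map_v_inv, map_ser_u, map_ser_v) !map_mx_entry.
Qed.

Lemma map_flip_mx : map_mx f (flip_mx A n) = flip_mx A' n.
Proof.
rewrite /flip_mx raddf_sum; apply: eq_bigr => i _.
rewrite raddf_sum; apply: eq_bigr => j _ /=. by rewrite map_mxT !map_delta_mx.
Qed.

Lemma map_reflection_eqn (B : fps 'M[A]_n) :
  fps_map (fps_map (map_mx f)) (reflection_eqn B)
    = reflection_eqn (fps_map (map_mx f) B).
Proof.
have map1 : fps_map (map_mx f) (fps_map (@mx_in1 A n) B)
    = fps_map (@mx_in1 A' n) (fps_map (map_mx f) B).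
  by apply/fpsP => r /=; rewrite map_mxT map_scalar_mx rmorph1.
have map2 : fps_map (map_mx f) (fps_map (@mx_in2 A n) B)
    = fps_map (@mx_in2 A' n) (fps_map (map_mx f) B).
  by apply/fpsP => r /=; rewrite map_mxT map_scalar_mx rmorph1.
by rewrite /reflection_eqn /R_sub /R_add !(rmorphB, rmorphD, rmorphM) /=
  !(map_u_inv, map_v_inv, map_ser_c, map_ser_u, map_ser_v) /= map_flip_mx map1 map2.
Qed.

Lemma map_unitarity_eqn (B : fps 'M[A]_n) :
  fps_map (map_mx f) (unitarity_eqn B) = unitarity_eqn (fps_map (map_mx f) B).
Proof.
rewrite /unitarity_eqn rmorphB rmorphM rmorph1; congr (_ * _ - _).
by apply/fpsP => r /=; case: odd; rewrite ?raddfN.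
Qed.

Lemma map_sign_mx l : map_mx f (sign_mx A n l) = sign_mx A' n l.
Proof.
apply/matrixP => i j; rewrite !mxE; case: eqP => _; last by rewrite !mulr0n rmorph0.
by rewrite !mulr1n; case: ifP; rewrite ?rmorphN rmorph1.
Qed.

End RelationsMap.

(* The trivial solutions T(u) = 1 and B(u) = G, which give the counits. *)
Section TrivialSolutions.
Variables (K : comNzRingType) (n : nat).

Lemma yangian_eqn1 i j a b : yangian_eqn (fps_const (1%:M : 'M[K]_n)) i j a b = 0.
Proof.
have entry i' j' : mx_entry (fps_const (1%:M : 'M[K]_n)) i' j'
    = fps_const (i' == j')%:R.
  by apply/fpsP => -[|r] /=; rewrite mxE.
have su (x : K) : ser_u (fps_const x) = ser_c x.
  by apply/fpsP => -[|r] //=; apply/fpsP => -[].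
rewrite /yangian_eqn !entry !su /ser_v -!/(ser_c _) /ser_c -!rmorphM.
by rewrite mulrC subrr [X in _ - _ * X]subrr !mulr0 subrr.
Qed.

Let reflection_aux (Z : pzRingType) (a b c P X Y : Z) :
    (forall z, z * a = a * z) -> (forall z, z * b = b * z) ->
    (forall z, z * c = c * z) -> X * Y = Y * X -> P * X = Y * P ->
    P * Y = X * P -> X * X = 1 -> Y * Y = 1 ->
  (a - c * P) * X * (b - c * P) * Y = Y * (b - c * P) * X * (a - c * P).
Proof.
move=> aC bC cC XY PX PY XX YY.
have xPX t : (t - c * P) * X = t * X - c * (Y * P) by rewrite mulrBl -mulrA PX.
have xPY t : (t - c * P) * Y = t * Y - c * (X * P) by rewrite mulrBl -mulrA PY.
have cross z t : (forall z', z' * t = t * z') ->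
    z * (t - c * P) = t * z - c * (z * P).
  by move=> tC; rewrite mulrBr tC !mulrA cC.
have expand t t' Q Q' U V : (forall z, z * t = t * z) ->
    (forall z, z * t' = t' * z) ->
    (t * Q - c * U) * (t' * Q' - c * V)
      = t * t' * (Q * Q') - t * c * (Q * V) - (c * t' * (U * Q') - c * c * (U * V)).
  move=> tC tC'.
  have mulACA (w x y z : Z) : (forall z', z' * y = y * z') ->
      w * x * (y * z) = w * y * (x * z).
    by move=> yC; rewrite mulrA -(mulrA w) yC !mulrA.
  by rewrite mulrBl !mulrBr !(mulACA _ _ t') // !(mulACA _ _ c).
rewrite -[LHS]mulrA -[RHS]mulrA xPX xPY !cross // !expand //.
have YPX : Y * P * X = P by rewrite -mulrA PX mulrA YY mul1r.
have YPY : Y * P * Y = X * Y * P by rewrite -mulrA PY mulrA XY.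
have XXP : X * (X * P) = P by rewrite mulrA XX mul1r.
have YXP : Y * (X * P) = X * Y * P by rewrite mulrA XY.
rewrite YPX YPY XXP YXP -XY -(bC a) -(aC c) -(bC c).
by rewrite !opprB addrACA [RHS]addrACA; congr (_ + _); rewrite addrC.
Qed.

Let u_inv_comm (R : pzRingType) (z : fps (fps R)) : z * u_inv R = u_inv R * z.
Proof.
rewrite /u_inv; have -> : ser_u (fps_X R) = fps_X _; last by rewrite fps_commX.
by apply/fpsP => r /=; rewrite rmorph_nat.
Qed.

Let v_inv_comm (R : pzRingType) (z : fps (fps R)) : z * v_inv R = v_inv R * z.
Proof.
apply/fpsP => r; rewrite [RHS]fpsME [LHS]fps_mul_rev.
by apply: eq_bigr => -[[|k] /= _] _; rewrite ?fps_commX ?mul0r ?mulr0.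
Qed.

Lemma sign_mx_sqr l : sign_mx K n l *m sign_mx K n l = 1%:M.
Proof.
rewrite mulmx_diag -[RHS]diag_const_mx; congr diag_mx; apply/rowP => i.
by rewrite !mxE; case: ifP; rewrite ?mulrNN mulr1.
Qed.

Lemma reflection_eqn_sign l : reflection_eqn (fps_const (sign_mx K n l)) = 0.
Proof.
set G := sign_mx K n l; have GG := sign_mx_sqr l : G *m G = 1%:M.
have in1 : ser_u (fps_map (@mx_in1 K n) (fps_const G)) = ser_c (mx_in1 G).
  apply/fpsP => -[|p] //=; rewrite /mx_in1 tens0mx.
  by apply/fpsP => -[].
have in2 : ser_v (fps_map (@mx_in2 K n) (fps_const G)) = ser_c (mx_in2 G).
  by congr fps_const; apply/fpsP => -[|q] //=; rewrite /mx_in2 tensmx0.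
have mxM (M N : 'M[K]_(n * n)) : M * N = M *m N by [].
apply/eqP; rewrite /reflection_eqn in1 in2 subr_eq0; apply/eqP.
have comc M N : ser_c M * ser_c N = ser_c (M *m N).
  by rewrite /ser_c -!rmorphM.
have tensM (M N M' N' : 'M[K]_n) : (M *t N) *m (M' *t N') = (M *m M') *t (N *m N').
  exact: tensmx_mul.
have flipE (M N : 'M[K]_n) : flip_mx K n *m (M *t N) = (N *t M) *m flip_mx K n.
  have dM (Q : 'M[K]_n) i j a c : (delta_mx i j *m Q) a c = (a == i)%:R * Q j c.
    rewrite mxE (bigD1 j) //= mxE eqxx andbT big1 ?addr0 // => k kj.
    by rewrite mxE (negPf kj) andbF mul0r.
  have Md (Q : 'M[K]_n) i j a c : (Q *m delta_mx i j) a c = Q a i * (c == j)%:R.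
    rewrite mxE (bigD1 i) //= mxE eqxx big1 ?addr0 // => k ki.
    by rewrite mxE (negPf ki) mulr0.
  have pick (h : 'I_n -> K) a : \sum_i (a == i)%:R * h i = h a.
    rewrite (bigD1 a) //= eqxx mul1r big1 ?addr0 // => k ka.
    by rewrite eq_sym (negPf ka) mul0r.
  apply/matrixP => ab cd.
  case: (mxtens_indexP ab) (mxtens_indexP cd) => a b [c d].
  transitivity (M b c * N a d).
    rewrite /flip_mx mulmx_suml summxE -(pick (fun i => M b c * N i d)).
    apply: eq_bigr => i _; rewrite mulmx_suml summxE.
    rewrite -(pick (fun j => M j c * N i d)) mulr_sumr.
    apply: eq_bigr => j _; rewrite tensM tensmxE !dM.
    by rewrite mulrACA !mulrA.
  rewrite /flip_mx mulmx_sumr summxE -(pick (fun i => M b c * N a i)).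
  apply: eq_bigr => i _; rewrite mulmx_sumr summxE.
  rewrite -(pick (fun j => M b j * N a i)) mulr_sumr.
  apply: eq_bigr => j _; rewrite tensM tensmxE !Md.
  by ring.
have tens11 : (1%:M : 'M[K]_n) *t (1%:M : 'M[K]_n) = 1%:M.
  apply/matrixP => ab cd.
  case: (mxtens_indexP ab) (mxtens_indexP cd) => a b [c d].
  by rewrite tensmxE !mxE (can_eq (@mxtens_indexK _ _)) xpair_eqE -natrM mulnb.
apply: reflection_aux.
- by move=> z; rewrite mulrBr mulrBl u_inv_comm v_inv_comm.
- by move=> z; rewrite mulrDr mulrDl u_inv_comm v_inv_comm.
- by move=> z; rewrite mulrA u_inv_comm -!mulrA v_inv_comm.
- by rewrite !comc !tensM !mulmx1 !mul1mx.
- by rewrite !comc flipE.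
- by rewrite !comc flipE.
- by rewrite comc tensM GG mulmx1 tens11 /ser_c !rmorph1.
- by rewrite comc tensM GG mulmx1 tens11 /ser_c !rmorph1.
Qed.

Lemma unitarity_eqn_sign l : unitarity_eqn (fps_const (sign_mx K n l)) = 0.
Proof.
rewrite /unitarity_eqn.
have -> : fps_neg (fps_const (sign_mx K n l)) = fps_const (sign_mx K n l).
  by apply/fpsP => -[|r] //=; rewrite oppr0 if_same.
by rewrite -rmorphM /= [X in fps_const X]sign_mx_sqr subrr.
Qed.

End TrivialSolutions.

Section Presentations.
Variables (K : comNzRingType) (n : nat).

(* The index (r, i, j) stands for the generator x_ij^(r+1). *)
Definition genFree := freeAlg K (nat * 'I_n * 'I_n)%type.

(* C + \sum_(r >= 1) x^(r) u^-r with free generators x_ij^(r) *)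
Definition free_ser (C : 'M[genFree]_n) : fps 'M[genFree]_n :=
  Fps (fun r => if r is r'.+1 then \matrix_(i, j) freeAlg_gen K (r', i, j) else C).

Definition genFree_counit : {rmorphism genFree -> K} := freeAlg_counit K _.

Lemma map_free_ser_counit C :
  fps_map (map_mx genFree_counit) (free_ser C) = fps_const (map_mx genFree_counit C).
Proof.
apply/fpsP => -[|r] //=; apply/matrixP => i j; rewrite !mxE.
exact: freeAlg_counit_gen.
Qed.

Definition yangian_rels : set genFree :=
  [set x | exists i j a b p q, x = yangian_eqn (free_ser 1%:M) i j a b p q].

Definition reflection_rels (l : nat) : set genFree :=
  [set x | (exists p q i j, x = reflection_eqn (free_ser (sign_mx _ n l)) p q i j)
        \/ (exists r i j, x = unitarity_eqn (free_ser (sign_mx _ n l)) r i j)].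

Lemma yangian_rels_counit x : yangian_rels x -> genFree_counit x = 0.
Proof.
move=> [i [j [a [b [p [q ->]]]]]].
transitivity (fps_map (fps_map genFree_counit)
                (yangian_eqn (free_ser 1%:M) i j a b) p q); first by [].
by rewrite map_yangian_eqn map_free_ser_counit map_scalar_mx rmorph1 yangian_eqn1.
Qed.

Lemma reflection_rels_counit l x : reflection_rels l x -> genFree_counit x = 0.
Proof.
case=> [[p [q [i [j ->]]]]|[r [i [j ->]]]].
  transitivity (fps_map (fps_map (map_mx genFree_counit))
      (reflection_eqn (free_ser (sign_mx _ n l))) p q i j).
    by rewrite !fps_mapE [RHS]mxE.
  rewrite map_reflection_eqn map_free_ser_counit map_sign_mx.
  by rewrite reflection_eqn_sign mxE.
transitivity (fps_map (map_mx genFree_counit)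
    (unitarity_eqn (free_ser (sign_mx _ n l))) r i j).
  by rewrite !fps_mapE [RHS]mxE.
rewrite map_unitarity_eqn map_free_ser_counit map_sign_mx.
by rewrite unitarity_eqn_sign mxE.
Qed.

Lemma yangian_proper : ~ two_sided_ideal yangian_rels 1.
Proof.
move=> /(two_sided_ideal_ker yangian_rels_counit) /eqP.
by rewrite rmorph1 oner_eq0.
Qed.

Lemma reflection_proper l : ~ two_sided_ideal (reflection_rels l) 1.
Proof.
move=> /(two_sided_ideal_ker (@reflection_rels_counit l)) /eqP.
by rewrite rmorph1 oner_eq0.
Qed.

(* Y(n) *)
Definition yangian : algType K := quotAlg yangian_proper.

(* B(n, l) *)
Definition reflection_algebra (l : nat) : algType K :=
  quotAlg (@reflection_proper l).

(* T(u), with coefficients T^(r) = (t_ij^(r)) and T^(0) = 1 *)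
Definition yangian_T : fps 'M[yangian]_n :=
  fps_map (map_mx (quotAlg_pi yangian_proper)) (free_ser 1%:M).

(* B(u), with coefficients B^(r) = (b_ij^(r)) and B^(0) = G *)
Definition reflection_B (l : nat) : fps 'M[reflection_algebra l]_n :=
  fps_map (map_mx (quotAlg_pi (@reflection_proper l)))
    (free_ser (sign_mx _ n l)).

End Presentations.

(* Main.v *)
(* The relation R(u-v) T_1(u) T_2(v) = T_2(v) T_1(u) R(u-v), combined with the
   exchange of the two tensor factors and with u |-> -u, v |-> -v, lets the
   R-matrices pass through the factors T(u), T(v), T^-1(-u), T^-1(-v), which
   reduces the reflection equation for T(u) G T^-1(-u) to the one for G.

   For injectivity, filter B(n,l) by giving b_ij^(r) the weight r.  The
   reflection equation makes generators commute modulo lower weight, and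
   unitarity eliminates half of them, so that an element of weight <= d is a
   polynomial in the remaining generators modulo lower weight.  Its top part is
   detected by representations of Y(n): a product of factors 1 + E u^-1 in which
   the matrix E of gl_n operators is made of the vector fields
   \sum_a x_ia d_ja + z x_ij, with x_ia shifted by z A_ia.  The part of highest
   degree in z of such a representation is the scalar point
   f = \prod (1 + A u^-1), so the top part vanishes at f G f^-1(-u).  These
   points take arbitrary values at the remaining generators of weight <= d, so
   the top part is zero as a polynomial, and induction on d finishes. *)

Require Import Defs.
From HB Require Import structures.
From mathcomp Require Import all_boot all_order all_algebra.
From mathcomp Require Import boolp classical_sets functions reals.
From mathcomp Require Import generic_quotient ring_quotient mxtens complex.
From mathcomp Require Import monalg zify.

Set Implicit Arguments.
Unset Strict Implicit.
Unset Printing Implicit Defensive.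

Import Order.TTheory GRing.Theory Num.Theory.
Local Open Scope ring_scope.

(** No basis theorem is used for either algebra: words spanning the reflection algebra, up to order
    and lower weight, and enough representations of Y(n) suffice. The obstacle is that a product of
    factors 1 + A u^-1 with constant matrices A is in general no representation of Y(n): the entries
    of A commute, whereas the relations ask for those of gl_n. It solves only the classical limit,
    and the operators in z quantize it. The vector fields \sum_a x_ia d_ja alone satisfy the gl_n
    relations, but after the shift of x their leading term in z is the operator \sum_a A_ia d_ja,
    not a scalar. The term z x_ij comes from formally conjugating by exp(z \sum_a x_aa), which turns
    d_ja into d_ja + z delta_ja and so keeps the relations; after the shift it leads with the scalar
    z^2 A_ij. Hence weight r is compared with degree 2r in z. Redundant and remaining generators are
    complementary: unitarity multiplies b_ij^(r) by eps_j + (-1)^r eps_i, while changing f by D in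
    degree r changes the point by (eps_j - (-1)^r eps_i) D_ij, and exactly one of these factors is
    nonzero. *)

Section Lifts.
Variables (K : comNzRingType) (X : choiceType) (A : nzRingType).
Variables (iota : {rmorphism K -> A}) (v : X -> A).
Hypothesis iotaC : forall c a, iota c * a = a * iota c.

Definition word_eval (m : {fmonom X}) : A := \prod_(x <- (m : seq X)) v x.

Fact word_eval_mmorphism : mmorphism word_eval.
Proof.
split=> [m1 m2|]; rewrite /word_eval; first by rewrite fmM big_cat.
by rewrite fm1 big_nil.
Qed.

HB.instance Definition _ :=
  monalg.isMultiplicative.Build {fmonom X} A word_eval word_eval_mmorphism.

(** Scalars enter through a central ring morphism [iota] instead of an algebra structure on the
    target, so that the lift also applies to polynomials over the ring of Weyl operators. *)
Definition freeAlg_lift : freeAlg K X -> A := mmap iota word_eval.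

HB.instance Definition _ := GRing.isZmodMorphism.Build (freeAlg K X) A
  freeAlg_lift (@mmap_is_additive _ _ _ iota word_eval).
Fact freeAlg_lift_monoid_morphism : monoid_morphism freeAlg_lift.
Proof.
have [liftM lift1] := @commr_mmap_is_multiplicative _ _ _ iota word_eval
  (fun g m m' => iotaC g@_m (word_eval m')).
by split.
Qed.

HB.instance Definition _ := GRing.isMonoidMorphism.Build (freeAlg K X) A
  freeAlg_lift freeAlg_lift_monoid_morphism.

Definition freeAlg_lift_rmorphism : {rmorphism freeAlg K X -> A} := freeAlg_lift.

Lemma freeAlg_liftU c m : freeAlg_lift << c *g m >> = iota c * word_eval m.
Proof. exact: mmapU. Qed.

Lemma freeAlg_lift_gen x : freeAlg_lift (freeAlg_gen K x) = v x.
Proof.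
by rewrite /freeAlg_gen freeAlg_liftU rmorph1 mul1r /word_eval fmU big_seq1.
Qed.

Lemma freeAlg_liftZ c f : freeAlg_lift (c *: f) = iota c * freeAlg_lift f.
Proof. exact: mmapZ. Qed.

Variable S : set (freeAlg K X).
Hypothesis S_proper : ~ two_sided_ideal S 1.
Hypothesis S0 : forall x, S x -> freeAlg_lift x = 0.
Local Notation Q := (quotAlg S_proper).

Definition quot_lift (q : Q) : A := freeAlg_lift (repr (q : Quotient.quot (ideal_pred S))).

Lemma quot_lift_pi x : quot_lift (quotAlg_pi S_proper x) = freeAlg_lift x.
Proof.
apply/eqP; rewrite -subr_eq0 -rmorphB; apply/eqP.
apply: (two_sided_ideal_ker S0); apply/(quotAlg_piP S_proper).
exact: quotAlg_repr.
Qed.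

Fact quot_lift_zmod_morphism : zmod_morphism quot_lift.
Proof.
elim/quotAlg_ind=> x; elim/quotAlg_ind=> y.
by rewrite -rmorphB !quot_lift_pi rmorphB.
Qed.

Fact quot_lift_monoid_morphism : monoid_morphism quot_lift.
Proof.
split=> [|]; first by rewrite -(rmorph1 (quotAlg_pi S_proper)) quot_lift_pi rmorph1.
elim/quotAlg_ind=> x; elim/quotAlg_ind=> y.
by rewrite -rmorphM !quot_lift_pi rmorphM.
Qed.

HB.instance Definition _ :=
  GRing.isZmodMorphism.Build Q A quot_lift quot_lift_zmod_morphism.
HB.instance Definition _ :=
  GRing.isMonoidMorphism.Build Q A quot_lift quot_lift_monoid_morphism.

Lemma quot_lift_gen x : quot_lift (quotAlg_pi S_proper (freeAlg_gen K x)) = v x.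
Proof. by rewrite quot_lift_pi freeAlg_lift_gen. Qed.

Lemma quot_liftZ c (q : Q) : quot_lift (c *: q) = iota c * quot_lift q.
Proof.
by elim/quotAlg_ind: q => x; rewrite -linearZ !quot_lift_pi freeAlg_liftZ.
Qed.

Lemma presented_lift : exists2 f : {rmorphism Q -> A},
  forall x, f (quotAlg_pi S_proper (freeAlg_gen K x)) = v x &
  forall c q, f (c *: q) = iota c * f q.
Proof. by exists quot_lift; [apply: quot_lift_gen | apply: quot_liftZ]. Qed.

End Lifts.

(** * Series in u^-1 and v^-1: coefficients, exchange of variables, sign changes *)

Section TwoVariableSeries.
Variable R : pzRingType.
Implicit Types (f g : fps R) (F G : fps (fps R)).

Lemma fps_constM (T : pzRingType) (a : T) (f : fps T) p : (fps_const a * f) p = a * f p.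
Proof.
by rewrite fpsME big_ord_recl subn0 big1 ?addr0 // => i _; rewrite mul0r.
Qed.

Lemma fps_Mconst (T : pzRingType) (a : T) (f : fps T) p : (f * fps_const a) p = f p * a.
Proof.
rewrite -[LHS]/(fps_mul f (fps_const a) p) fps_mul_rev.
by rewrite big_ord_recl subn0 big1 ?addr0 // => i _; rewrite mulr0.
Qed.

Lemma fps_XM (T : pzRingType) (f : fps T) p :
  (fps_X T * f) p = if p is p'.+1 then f p' else 0.
Proof.
rewrite fpsME; case: p => [|p]; first by rewrite big_ord1 mul0r.
rewrite big_ord_recl mul0r add0r big_ord_recl mul1r subSS subn0.
by rewrite big1 ?addr0 // => i _; rewrite mul0r.
Qed.

Lemma u_inv_X : u_inv R = fps_X (fps R).
Proof. by apply/fpsP => r /=; rewrite rmorph_nat. Qed.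

Lemma u_invE F p : (u_inv R * F) p = if p is p'.+1 then F p' else 0.
Proof. by rewrite u_inv_X fps_XM. Qed.

Lemma v_invE F p q : (v_inv R * F) p q = if q is q'.+1 then F p q' else 0.
Proof. by rewrite fps_constM fps_XM. Qed.

Lemma u_inv_comm F : F * u_inv R = u_inv R * F.
Proof. by rewrite u_inv_X fps_commX. Qed.

Lemma v_inv_comm F : F * v_inv R = v_inv R * F.
Proof.
apply/fpsP => r; rewrite [RHS]fpsME [LHS]fps_mul_rev.
by apply: eq_bigr => -[[|k] /= _] _; rewrite ?fps_commX ?mul0r ?mulr0.
Qed.

Lemma ser_uvE f g p q : (ser_u f * ser_v g) p q = f p * g q.
Proof. by rewrite fps_Mconst fps_constM. Qed.

Lemma ser_vuE f g p q : (ser_v g * ser_u f) p q = g q * f p.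
Proof. by rewrite fps_constM fps_Mconst. Qed.

Lemma ser_cM a F p q : (ser_c a * F) p q = a * F p q.
Proof. by rewrite /ser_c !fps_constM. Qed.

Lemma ser_Mc a F p q : (F * ser_c a) p q = F p q * a.
Proof. by rewrite /ser_c !fps_Mconst. Qed.

Definition swap_uv F : fps (fps R) := Fps (fun p => Fps (fun q => F q p)).

Fact swap_uv_zmod_morphism : zmod_morphism swap_uv.
Proof. by move=> F G; apply/fpsP => p; apply/fpsP. Qed.

Fact swap_uv_monoid_morphism : monoid_morphism swap_uv.
Proof.
split=> [|F G]; apply/fpsP => p; apply/fpsP => q.
  by case: p q => [|p] [|q].
rewrite -[LHS]/((F * G) q p) !fpsME.
rewrite fps_sumE; under eq_bigr do rewrite fpsME.
by rewrite exchange_big /= fps_sumE.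
Qed.

HB.instance Definition _ := GRing.isZmodMorphism.Build (fps (fps R)) (fps (fps R))
  swap_uv swap_uv_zmod_morphism.
HB.instance Definition _ := GRing.isMonoidMorphism.Build (fps (fps R)) (fps (fps R))
  swap_uv swap_uv_monoid_morphism.

Definition swap_uv_rmorphism : {rmorphism fps (fps R) -> fps (fps R)} := swap_uv.

Lemma swap_ser_u f : swap_uv (ser_u f) = ser_v f.
Proof. by apply/fpsP => -[|p]; apply/fpsP => -[|q]. Qed.

Lemma swap_ser_v f : swap_uv (ser_v f) = ser_u f.
Proof. by apply/fpsP => -[|p]; apply/fpsP => -[|q]. Qed.

Lemma swap_ser_c a : swap_uv (ser_c a) = ser_c a.
Proof. by apply/fpsP => -[|p]; apply/fpsP => -[|q]. Qed.

End TwoVariableSeries.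

Section Negation.
Variable R : pzRingType.

Lemma fps_negE (f : fps R) r : fps_neg f r = (-1) ^+ r * f r.
Proof. by rewrite /= -signr_odd; case: odd; rewrite ?mulN1r ?mul1r. Qed.

Fact fps_neg_zmod_morphism : zmod_morphism (@fps_neg R).
Proof. by move=> f g; apply/fpsP => r; rewrite !(fps_negE, fpsE) mulrBr. Qed.

Fact fps_neg_monoid_morphism : monoid_morphism (@fps_neg R).
Proof.
split=> [|f g]; apply/fpsP => r; rewrite !(fps_negE, fpsE).
  by case: r => [|r]; rewrite ?mulr1 ?mulr0.
rewrite mulr_sumr; apply: eq_bigr => i _; rewrite !fps_negE.
rewrite -{1}(@subnKC i r) -1?ltnS // exprD -!mulrA; congr (_ * _).
by rewrite -signr_odd; case: odd; rewrite ?mul1r // !mulN1r mulrN.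
Qed.

HB.instance Definition _ := GRing.isZmodMorphism.Build (fps R) (fps R)
  (@fps_neg R) fps_neg_zmod_morphism.
HB.instance Definition _ := GRing.isMonoidMorphism.Build (fps R) (fps R)
  (@fps_neg R) fps_neg_monoid_morphism.

Definition fps_neg_rmorphism : {rmorphism fps R -> fps R} := @fps_neg R.

Lemma fps_negK : involutive (@fps_neg R).
Proof. by move=> f; apply/fpsP => r /=; case: odd; rewrite ?opprK. Qed.

Lemma fps_neg_const (a : R) : fps_neg (fps_const a) = fps_const a.
Proof. by apply/fpsP => -[|r] //=; rewrite oppr0 if_same. Qed.

Lemma fps_neg_map (S : pzRingType) (f : {additive R -> S}) (g : fps R) :
  fps_neg (fps_map f g) = fps_map f (fps_neg g).
Proof. by apply/fpsP => r /=; case: odd; rewrite ?raddfN. Qed.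

Lemma fps_neg_X : fps_neg (fps_X R) = - fps_X R.
Proof. by apply/fpsP => -[|[|r]] /=; rewrite ?oppr0 ?if_same. Qed.

End Negation.

Section NegationTwoVariables.
Variable R : pzRingType.

Definition neg_u : {rmorphism fps (fps R) -> fps (fps R)} := fps_neg_rmorphism (fps R).
Definition neg_v : {rmorphism fps (fps R) -> fps (fps R)} := fps_map (fps_neg_rmorphism R).

Lemma neg_u_ser_u (f : fps R) : neg_u (ser_u f) = ser_u (fps_neg f).
Proof. exact: fps_neg_map. Qed.
Lemma neg_v_ser_u (f : fps R) : neg_v (ser_u f) = ser_u f.
Proof. by apply/fpsP => r /=; rewrite fps_neg_const. Qed.
Lemma neg_u_ser_v (f : fps R) : neg_u (ser_v f) = ser_v f.
Proof. exact: fps_neg_const. Qed.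
Lemma neg_v_ser_v (f : fps R) : neg_v (ser_v f) = ser_v (fps_neg f).
Proof. exact: (fps_map_const (fps_neg_rmorphism R)). Qed.
Lemma neg_u_ser_c (a : R) : neg_u (ser_c a) = ser_c a.
Proof. exact: fps_neg_const. Qed.
Lemma neg_v_ser_c (a : R) : neg_v (ser_c a) = ser_c a.
Proof.
rewrite /ser_c -[RHS](congr1 _ (fps_neg_const a)).
exact: (fps_map_const (fps_neg_rmorphism R)).
Qed.

Lemma neg_u_inv : (neg_u (u_inv R) = - u_inv R) * (neg_v (u_inv R) = u_inv R).
Proof.
split; last by rewrite neg_v_ser_u.
by rewrite u_inv_X; apply: fps_neg_X.
Qed.

Lemma neg_v_inv : (neg_v (v_inv R) = - v_inv R) * (neg_u (v_inv R) = v_inv R).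
Proof.
split; last by rewrite neg_u_ser_v.
by rewrite /v_inv neg_v_ser_v fps_neg_X /ser_v raddfN.
Qed.

End NegationTwoVariables.

(** * Entries of the two embeddings into the tensor square, and of the flip P *)

Section TensorEntries.
Variables (A : pzRingType) (n : nat).
Local Notation idx i a := (@mxtens_index n n (i, a)).
Implicit Types (M N : 'M[A]_n) (X Y : 'M[A]_(n * n)).

Lemma sum_mxtens_index (F : 'I_(n * n) -> A) :
  \sum_k F k = \sum_i \sum_a F (idx i a).
Proof.
rewrite pair_big /= (reindex (@mxtens_index n n)) /=.
  by apply: eq_bigr => -[].
by exists (@mxtens_unindex n n) => k _; rewrite (mxtens_indexK, mxtens_unindexK).
Qed.

Lemma tens_matrixP X Y :
  (forall i a j b, X (idx i a) (idx j b) = Y (idx i a) (idx j b)) -> X = Y.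
Proof.
move=> XY; apply/matrixP => k k'.
by case: (mxtens_indexP k) (mxtens_indexP k') => i a [j b].
Qed.

Lemma mul_tensE X Y i a j b : (X * Y) (idx i a) (idx j b)
  = \sum_c \sum_d X (idx i a) (idx c d) * Y (idx c d) (idx j b).
Proof. by rewrite mxE sum_mxtens_index. Qed.

Lemma in1E M i a j b : mx_in1 M (idx i a) (idx j b) = M i j *+ (a == b).
Proof. by rewrite tensmxE mxE mulr_natr. Qed.

Lemma in2E M i a j b : mx_in2 M (idx i a) (idx j b) = M a b *+ (i == j).
Proof. by rewrite tensmxE mxE mulr_natl. Qed.

Lemma sum_pick (T : finType) (V : nmodType) (F : T -> V) (i : T) :
  \sum_k F k *+ (i == k) = F i.
Proof.
rewrite (bigD1 i) //= eqxx big1 ?addr0 // => k /negPf ki.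
by rewrite eq_sym ki.
Qed.

Lemma in1M_E M X i a j b :
  (mx_in1 M * X) (idx i a) (idx j b) = \sum_c M i c * X (idx c a) (idx j b).
Proof.
rewrite mul_tensE; apply: eq_bigr => c _.
rewrite -[RHS](sum_pick (fun d => M i c * X (idx c d) (idx j b)) a).
by apply: eq_bigr => d _; rewrite in1E mulrnAl.
Qed.

Lemma in2M_E M X i a j b :
  (mx_in2 M * X) (idx i a) (idx j b) = \sum_d M a d * X (idx i d) (idx j b).
Proof.
rewrite mul_tensE exchange_big; apply: eq_bigr => d _.
rewrite -[RHS](sum_pick (fun c => M a d * X (idx c d) (idx j b)) i).
by apply: eq_bigr => c _; rewrite in2E mulrnAl.
Qed.

Lemma in12E M N i a j b : (mx_in1 M * mx_in2 N) (idx i a) (idx j b) = M i j * N a b.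
Proof.
rewrite in1M_E -[RHS](sum_pick (fun c => M i c * N a b) j).
by apply: eq_bigr => c _; rewrite in2E eq_sym mulrnAr.
Qed.

Lemma in21E M N i a j b : (mx_in2 M * mx_in1 N) (idx i a) (idx j b) = M a b * N i j.
Proof.
rewrite in2M_E -[RHS](sum_pick (fun c => M a c * N i j) b).
by apply: eq_bigr => c _; rewrite in1E eq_sym mulrnAr.
Qed.

Lemma flipE i a j b : flip_mx A n (idx i a) (idx j b) = ((i == b) && (a == j))%:R.
Proof.
rewrite /flip_mx summxE.
under eq_bigr => i' _ do rewrite summxE.
under eq_bigr => i' _.
  under eq_bigr => j' _ do rewrite tensmxE !mxE -natrM mulnb.
  over.
rewrite (bigD1 i) //= [X in _ + X]big1 ?addr0 => [|i' /negPf ii']; last first.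
  by rewrite big1 // => j' _; rewrite eq_sym ii'.
rewrite (bigD1 j) //= [X in _ + X]big1 ?addr0 => [|j' /negPf jj']; last first.
  by rewrite [j == _]eq_sym jj' andbF.
by rewrite !eqxx /= andbC [b == i]eq_sym.
Qed.

Lemma flipM_E X i a j b : (flip_mx A n * X) (idx i a) (idx j b) = X (idx a i) (idx j b).
Proof.
rewrite mul_tensE -[RHS](sum_pick (fun c => X (idx c i) (idx j b)) a).
apply: eq_bigr => c _; rewrite -[in RHS](sum_pick (fun d => X (idx c d) (idx j b)) i).
rewrite -sumrMnl; apply: eq_bigr => d _.
by rewrite flipE mulr_natl -mulrnA mulnb andbC.
Qed.

Lemma Mflip_E X i a j b : (X * flip_mx A n) (idx i a) (idx j b) = X (idx i a) (idx b j).
Proof.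
rewrite mul_tensE -[RHS](sum_pick (fun c => X (idx i a) (idx c j)) b).
apply: eq_bigr => c _; rewrite -[in RHS](sum_pick (fun d => X (idx i a) (idx c d)) j).
rewrite -sumrMnl; apply: eq_bigr => d _.
by rewrite flipE mulr_natr -mulrnA mulnb [d == j]eq_sym [c == b]eq_sym andbC.
Qed.

Lemma flip_flip : flip_mx A n * flip_mx A n = 1.
Proof.
apply: tens_matrixP => i a j b; rewrite flipM_E flipE mxE.
by rewrite (can_eq (@mxtens_indexK n n)) xpair_eqE andbC.
Qed.

Lemma flip_in1 M : flip_mx A n * mx_in1 M = mx_in2 M * flip_mx A n.
Proof. by apply: tens_matrixP => i a j b; rewrite flipM_E Mflip_E in1E in2E. Qed.

Lemma flip_in2 M : flip_mx A n * mx_in2 M = mx_in1 M * flip_mx A n.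
Proof. by apply: tens_matrixP => i a j b; rewrite flipM_E Mflip_E in1E in2E. Qed.

Fact in1_zmod_morphism : zmod_morphism (@mx_in1 A n).
Proof.
by move=> M N; apply: tens_matrixP => i a j b; rewrite [RHS]mxE [X in _ = _ + X]mxE !in1E !mxE mulrnBl.
Qed.
Fact in2_zmod_morphism : zmod_morphism (@mx_in2 A n).
Proof.
by move=> M N; apply: tens_matrixP => i a j b; rewrite [RHS]mxE [X in _ = _ + X]mxE !in2E !mxE mulrnBl.
Qed.

Fact in1_monoid_morphism : monoid_morphism (@mx_in1 A n).
Proof.
split=> [|M N]; apply: tens_matrixP => i a j b.
  by rewrite in1E !mxE (can_eq (@mxtens_indexK n n)) xpair_eqE -mulrnA mulnb.
rewrite in1M_E in1E mxE -sumrMnl; apply: eq_bigr => c _.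
by rewrite in1E mulrnAr.
Qed.
Fact in2_monoid_morphism : monoid_morphism (@mx_in2 A n).
Proof.
split=> [|M N]; apply: tens_matrixP => i a j b.
  by rewrite in2E !mxE (can_eq (@mxtens_indexK n n)) xpair_eqE -mulrnA mulnb andbC.
rewrite in2M_E in2E mxE -sumrMnl; apply: eq_bigr => c _.
by rewrite in2E mulrnAr.
Qed.

HB.instance Definition _ := GRing.isZmodMorphism.Build 'M[A]_n 'M[A]_(n * n)
  (@mx_in1 A n) in1_zmod_morphism.
HB.instance Definition _ := GRing.isMonoidMorphism.Build 'M[A]_n 'M[A]_(n * n)
  (@mx_in1 A n) in1_monoid_morphism.
HB.instance Definition _ := GRing.isZmodMorphism.Build 'M[A]_n 'M[A]_(n * n)
  (@mx_in2 A n) in2_zmod_morphism.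
HB.instance Definition _ := GRing.isMonoidMorphism.Build 'M[A]_n 'M[A]_(n * n)
  (@mx_in2 A n) in2_monoid_morphism.

Definition B1 : {rmorphism fps 'M[A]_n -> fps (fps 'M[A]_(n * n))} :=
  (fps_map (@fps_const 'M[A]_(n * n))) \o (fps_map (@mx_in1 A n)).
Definition B2 : {rmorphism fps 'M[A]_n -> fps (fps 'M[A]_(n * n))} :=
  (@fps_const (fps 'M[A]_(n * n))) \o (fps_map (@mx_in2 A n)).

End TensorEntries.

Arguments B1 {A n}.
Arguments B2 {A n}.

(** * The matrix form of the Yangian relations and its variants *)

Section RTT.
Variables (A : pzRingType) (n : nat) (T : fps 'M[A]_n).
Local Notation idx i a := (@mxtens_index n n (i, a)).
Local Notation P := (ser_c (flip_mx A n)).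
Local Notation Rs := (R_sub A n).
Local Notation Ra := (R_add A n).
Local Notation T' := (fps_neg T).

Lemma B12E (f g : fps 'M[A]_n) p q i a j b :
  (B1 f * B2 g) p q (idx i a) (idx j b) = f p i j * g q a b.
Proof. by rewrite ser_uvE in12E. Qed.

Lemma B21E (f g : fps 'M[A]_n) p q i a j b :
  (B2 g * B1 f) p q (idx i a) (idx j b) = g q a b * f p i j.
Proof. by rewrite ser_vuE in21E. Qed.

(** Multiplying by P from the left exchanges the row indices i and a, and from the right the column
    indices j and b; this produces the products t_aj t_ib on the right-hand side of the Yangian
    relation. *)
Lemma RTT_entry p q i j a b :
  (Rs * (B1 T * B2 T) - B2 T * B1 T * Rs) p q (idx i a) (idx j b)
    = yangian_eqn T i j a b p q.
Proof.
set X := B1 T * B2 T; set Y := B2 T * B1 T.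
have -> : Rs * X = v_inv _ * X - u_inv _ * X - u_inv _ * (v_inv _ * (P * X)).
  by rewrite /R_sub !mulrBl !mulrA.
have -> : Y * Rs = v_inv _ * Y - u_inv _ * Y - u_inv _ * (v_inv _ * (Y * P)).
  rewrite /R_sub !mulrBr !(mulrA Y) !u_inv_comm -(mulrA (u_inv _) Y).
  by rewrite !(v_inv_comm Y) !mulrA.
rewrite /yangian_eqn -[u_inv A * _ * _]mulrA mulrBl.
have addE (M N : 'M[A]_(n * n)) x y : (M + N) x y = M x y + N x y by rewrite mxE.
have oppE (M : 'M[A]_(n * n)) x y : (- M) x y = - M x y by rewrite mxE.
have zeroE x y : (0 : 'M[A]_(n * n)) x y = 0 by rewrite mxE.
have subBB (V : zmodType) (x y z x' y' z' : V) :
    x - y - z - (x' - y' - z') = x - x' - (y - y') - (z - z').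
  by rewrite !opprD !opprK addrACA [X in X + _]addrACA.
rewrite !(fpsDE, fpsNE) !(addE, oppE) subBB.
case: p q => [|p] [|q]; rewrite !(u_invE, v_invE) ?(ser_cM, ser_Mc) ?fps0E;
  rewrite ?(fpsDE, fpsNE, ser_uvE, ser_vuE) /=;
  rewrite ?(addE, oppE, zeroE, flipM_E, Mflip_E) ?(in12E, in21E) ?subr0;
  by rewrite ?subr0.
Qed.

Lemma yangian_of_RTT : Rs * (B1 T * B2 T) = B2 T * B1 T * Rs ->
  forall i j a b, yangian_eqn T i j a b = 0.
Proof.
move=> /eqP; rewrite -subr_eq0 => /eqP RTT0 i j a b.
by apply/fpsP => p; apply/fpsP => q; rewrite -RTT_entry RTT0 mxE.
Qed.

Hypothesis T_yangian : forall i j a b, yangian_eqn T i j a b = 0.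

Lemma RTT : Rs * (B1 T * B2 T) = B2 T * B1 T * Rs.
Proof.
apply/eqP; rewrite -subr_eq0; apply/eqP.
apply/fpsP => p; apply/fpsP => q; apply: tens_matrixP => i a j b.
by rewrite RTT_entry T_yangian mxE.
Qed.

Lemma ser_c_uv (a : 'M[A]_(n * n)) :
  (ser_c a * u_inv _ = u_inv _ * ser_c a) * (ser_c a * v_inv _ = v_inv _ * ser_c a).
Proof. by split; [apply: u_inv_comm | apply: v_inv_comm]. Qed.

Let flip_conj (Z : pzRingType) (r p a b a' b' : Z) : p * p = 1 -> p * r = r * p ->
  p * a = a' * p -> p * b = b' * p -> r * (a * b) = b * a * r ->
  r * (a' * b') = b' * a' * r.
Proof.
move=> pp pr pa pb rab.
have aE : a' = p * a * p by rewrite pa -mulrA pp mulr1.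
have bE : b' = p * b * p by rewrite pb -mulrA pp mulr1.
have abE : a' * b' = p * (a * b) * p.
  by rewrite aE bE -!mulrA (mulrA p p) pp mul1r.
have baE : b' * a' = p * (b * a) * p.
  by rewrite aE bE -!mulrA (mulrA p p) pp mul1r.
by rewrite abE baE !mulrA -pr -(mulrA p r) -(mulrA p) -(mulrA r) rab -!mulrA pr.
Qed.

Let RTT_neg (f : {rmorphism fps (fps 'M[A]_(n * n)) -> fps (fps 'M[A]_(n * n))})
    r x y : r * (x * y) = y * x * r -> f r * (f x * f y) = f y * f x * f r.
Proof. by rewrite -!rmorphM => ->. Qed.

(** Here [r] is u^-1 v^-1 (v - u) R(v - u). Exchanging u and v in the RTT relation gives a statement
    about T_1(v) and T_2(u); conjugation by P, an involution commuting with [r], then restores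
    T_1(u) and T_2(v) with their order reversed. *)
Lemma RTT_swap (r := u_inv _ - v_inv _ - u_inv _ * v_inv _ * P) :
  r * (B2 T * B1 T) = B1 T * B2 T * r.
Proof.
pose a := ser_v (fps_map (@mx_in1 A n) T).
pose b := ser_u (fps_map (@mx_in2 A n) T).
apply: (@flip_conj _ r P a b).
- by rewrite /ser_c -!rmorphM /= flip_flip !rmorph1.
- have [uP vP] := ser_c_uv (flip_mx A n).
  rewrite /r !mulrBr !mulrBl (mulrA P) (mulrA P (u_inv _)) uP vP.
  by congr (_ - _); rewrite -!mulrA (mulrA P (v_inv _)) vP -!mulrA.
- apply/fpsP => p; apply/fpsP => q; rewrite ser_cM ser_Mc /=.
  by case: p => [|p] /=; rewrite ?flip_in1 ?mulr0 ?mul0r.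
- apply/fpsP => p; apply/fpsP => q; rewrite ser_cM ser_Mc /=.
  by case: q => [|q] /=; rewrite ?flip_in2 ?mulr0 ?mul0r.
pose sw := swap_uv_rmorphism 'M[A]_(n * n).
have := RTT_neg sw RTT.
have -> : sw (B1 T) = a by apply: swap_ser_u.
have -> : sw (B2 T) = b by apply: swap_ser_v.
have -> // : sw Rs = r.
have swc x : sw (ser_c x) = ser_c x by apply: swap_ser_c.
have swu : sw (u_inv _) = v_inv _ by apply: swap_ser_u.
have swv : sw (v_inv _) = u_inv _ by apply: swap_ser_v.
by rewrite /R_sub /r !rmorphB !rmorphM swc swu swv -v_inv_comm.
Qed.

Lemma neg_u_B1 (f : fps 'M[A]_n) : neg_u _ (B1 f) = B1 (fps_neg f).
Proof. by rewrite [LHS]neg_u_ser_u fps_neg_map. Qed.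
Lemma neg_v_B2 (f : fps 'M[A]_n) : neg_v _ (B2 f) = B2 (fps_neg f).
Proof. by rewrite [LHS]neg_v_ser_v fps_neg_map. Qed.
Lemma neg_v_B1 (f : fps 'M[A]_n) : neg_v _ (B1 f) = B1 f.
Proof. exact: neg_v_ser_u. Qed.
Lemma neg_u_B2 (f : fps 'M[A]_n) : neg_u _ (B2 f) = B2 f.
Proof. exact: neg_u_ser_v. Qed.

(** Under v -> -v the series [R_sub], that is u^-1 v^-1 (u - v - P), becomes [- R_add], and the sign
    cancels on both sides. The next two relations arise in the same way from u -> -u in [RTT_swap]
    and then v -> -v. *)
Lemma RTT_uv : Ra * (B1 T * B2 T') = B2 T' * B1 T * Ra.
Proof.
have := RTT_neg (neg_v _) RTT; rewrite neg_v_B1 neg_v_B2.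
have -> : neg_v _ Rs = - Ra.
  rewrite /R_sub !(rmorphB, rmorphM) /= !neg_u_inv !neg_v_inv neg_v_ser_c.
  by rewrite mulrN mulNr !opprD !opprK.
by rewrite !(mulrN, mulNr) => /oppr_inj.
Qed.

Lemma RTT_vu : Ra * (B2 T * B1 T') = B1 T' * B2 T * Ra.
Proof.
have := RTT_neg (neg_u _) RTT_swap; rewrite neg_u_B1 neg_u_B2.
have -> : neg_u _ (u_inv _ - v_inv _ - u_inv _ * v_inv _ * P) = - Ra.
  rewrite !(rmorphB, rmorphM) /= !neg_u_inv !neg_v_inv neg_u_ser_c.
  by rewrite !mulNr !opprD !opprK [- u_inv _ - v_inv _]addrC.
by rewrite !(mulrN, mulNr) => /oppr_inj.
Qed.

Lemma RTT_neg_vu : Rs * (B2 T' * B1 T') = B1 T' * B2 T' * Rs.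
Proof.
have := RTT_neg (neg_v _) RTT_vu; rewrite neg_v_B1 neg_v_B2.
have -> : neg_v _ Ra = - Rs.
  rewrite /R_add !(rmorphB, rmorphD, rmorphM) /= !neg_u_inv !neg_v_inv neg_v_ser_c.
  by rewrite mulrN mulNr !opprD !opprK.
by rewrite !(mulrN, mulNr) => /oppr_inj.
Qed.

End RTT.

(** To be read with r = R(u-v), s = R(u+v), a = T_1(u), b = T_2(v), c = T_1(-u), d = T_2(-v), c' and
    d' the inverses of c and d, g = G_1 and h = G_2. *)
Lemma reflection_chain (Z : pzRingType) (r s a b c d c' d' g h : Z) :
  r * (a * b) = b * a * r -> s * (a * d) = d * a * s ->
  s * (b * c) = c * b * s -> r * (d * c) = c * d * r ->
  c * c' = 1 -> c' * c = 1 -> d * d' = 1 -> d' * d = 1 ->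
  b * g = g * b -> a * h = h * a -> c' * h = h * c' -> d' * g = g * d' ->
  r * g * s * h = h * s * g * r ->
  r * (a * g * c') * s * (b * h * d') = b * h * d' * s * (a * g * c') * r.
Proof.
move=> rab sad sbc rdc cc c'c dd d'd bg ah ch dg rgsh.
have csb : c' * s * b = b * s * c'.
  transitivity (c' * (s * (b * c)) * c'); first by rewrite -!mulrA cc mulr1.
  by rewrite sbc !mulrA c'c mul1r.
have dsa : d' * s * a = a * s * d'.
  transitivity (d' * (s * (a * d)) * d'); first by rewrite -!mulrA dd mulr1.
  by rewrite sad !mulrA d'd mul1r.
have rcd : r * (c' * d') = d' * c' * r.
  transitivity (d' * c' * (c * d * r) * (c' * d')).
    by rewrite !mulrA -(mulrA d' c' c) c'c mulr1 d'd mul1r.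
  by rewrite -rdc -!mulrA (mulrA c c') cc mul1r dd mulr1.
have csbx x : c' * (s * (b * x)) = b * (s * (c' * x)) by rewrite !mulrA csb.
have dsax x : d' * (s * (a * x)) = a * (s * (d' * x)) by rewrite !mulrA dsa.
have bgx x : b * (g * x) = g * (b * x) by rewrite !mulrA bg.
have ahx x : a * (h * x) = h * (a * x) by rewrite !mulrA ah.
have chx x : c' * (h * x) = h * (c' * x) by rewrite !mulrA ch.
have dgx x : d' * (g * x) = g * (d' * x) by rewrite !mulrA dg.
(* Both T factors are collected on the left and both inverses on the right, so that R(u-v) meets T_1
   T_2, then the equation for G applies, and finally R(u-v) passes the inverses. The last line
   undoes the collecting in mirror order. *)
transitivity (r * (a * b) * g * s * h * (c' * d')).
  by rewrite -!mulrA csbx -bgx chx.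
transitivity (b * a * (r * g * s * h) * (c' * d')); first by rewrite rab !mulrA.
by rewrite rgsh -!mulrA rcd -!mulrA ahx dsax dgx.
Qed.

Lemma fps_inv_map (R S : pzRingType) (f : {rmorphism R -> S}) (g : fps R) :
  fps_map f (fps_inv g) = fps_inv (fps_map f g).
Proof.
apply/fpsP => r /=; rewrite rmorph_sum; apply: eq_bigr => k _.
rewrite -[LHS]/(fps_map f ((1 - g) ^+ k) r).
by rewrite rmorphXn rmorphB rmorph1.
Qed.

Definition twisted (A : pzRingType) n l (T : fps 'M[A]_n) : fps 'M[A]_n :=
  T * fps_const (sign_mx A n l) * fps_neg (fps_inv T).

(** * The series T(u) G T^-1(-u) satisfies the reflection relations *)

Section YangianToReflection.
Variables (K : comNzRingType) (A : algType K) (n l : nat) (T : fps 'M[A]_n).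
Hypothesis T_yangian : forall i j a b, yangian_eqn T i j a b = 0.
Hypothesis T0 : T 0 = 1.
Local Notation G := (fps_const (sign_mx A n l)).
Local Notation twisted := (twisted l T).

Lemma map_sign_alg : map_mx (in_alg A) (sign_mx K n l) = sign_mx A n l.
Proof. exact: (map_sign_mx (in_alg A)). Qed.

Lemma sign_mx_sqr_alg : sign_mx A n l * sign_mx A n l = 1.
Proof.
rewrite -map_sign_alg -[LHS](map_mxM (in_alg A)) sign_mx_sqr.
by rewrite map_scalar_mx rmorph1.
Qed.

(** The constant solution G is known over the commutative ring K; its entries lie in the image of K,
    so the equation is transported along K -> A. *)
Lemma reflection_eqn_sign_alg : reflection_eqn G = 0.
Proof.
have := congr1 (fps_map (fps_map (map_mx (in_alg A)))) (reflection_eqn_sign K n l).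
rewrite (map_reflection_eqn (in_alg A)) !rmorph0 => H.
rewrite -[RHS]H; congr reflection_eqn.
by apply/fpsP => -[|r] /=; rewrite ?map_sign_alg ?raddf0.
Qed.

Lemma sign_central i j (x : A) : x * sign_mx A n l i j = sign_mx A n l i j * x.
Proof. by rewrite -map_sign_alg mxE /= mulr_algl mulr_algr. Qed.

Lemma B1_sign_comm (f : fps 'M[A]_n) : B1 f * B2 G = B2 G * B1 f.
Proof.
apply/fpsP => p; apply/fpsP => q; apply: tens_matrixP => i a j b.
rewrite B12E B21E /=; case: q => [|q]; first exact: sign_central.
by rewrite mxE mulr0 mul0r.
Qed.

Lemma B2_sign_comm (f : fps 'M[A]_n) : B2 f * B1 G = B1 G * B2 f.
Proof.
apply/fpsP => p; apply/fpsP => q; apply: tens_matrixP => i a j b.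
rewrite B12E B21E /=; case: p => [|p]; first exact: sign_central.
by rewrite mxE mulr0 mul0r.
Qed.

Lemma reflection_eqnE (f : fps 'M[A]_n) : reflection_eqn f =
  R_sub A n * B1 f * R_add A n * B2 f - B2 f * R_add A n * B1 f * R_sub A n.
Proof. by []. Qed.

Lemma reflection_twisted : reflection_eqn twisted = 0.
Proof.
have [TI IT] := fps_inv_comm T0.
rewrite reflection_eqnE; apply/eqP; rewrite subr_eq0; apply/eqP.
have twE (f : {rmorphism fps 'M[A]_n -> fps (fps 'M[A]_(n * n))}) :
    f twisted = f T * f G * f (fps_neg (fps_inv T)).
  by rewrite /twisted !rmorphM.
rewrite !twE.
apply: (@reflection_chain _ (R_sub A n) (R_add A n) (B1 T) (B2 T)
  (B1 (fps_neg T)) (B2 (fps_neg T)) (B1 (fps_neg (fps_inv T)))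
  (B2 (fps_neg (fps_inv T))) (B1 G) (B2 G)).
- exact: RTT.
- exact: RTT_uv.
- exact: RTT_vu.
- exact: RTT_neg_vu.
- by rewrite -!rmorphM TI !rmorph1.
- by rewrite -!rmorphM IT !rmorph1.
- by rewrite -!rmorphM TI !rmorph1.
- by rewrite -!rmorphM IT !rmorph1.
- exact: B2_sign_comm.
- exact: B1_sign_comm.
- exact: B1_sign_comm.
- exact: B2_sign_comm.
have := reflection_eqn_sign_alg; rewrite reflection_eqnE => /eqP.
by rewrite subr_eq0 => /eqP.
Qed.

Lemma unitarity_twisted : unitarity_eqn twisted = 0.
Proof.
have [TI IT] := fps_inv_comm T0.
rewrite /unitarity_eqn /twisted !rmorphM /= fps_negK fps_neg_const.
have GG : G * G = 1 by rewrite -rmorphM /= sign_mx_sqr_alg.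
have nIT : fps_neg (fps_inv T) * fps_neg T = 1 by rewrite -rmorphM IT rmorph1.
rewrite !mulrA -(mulrA _ (fps_neg (fps_inv T))) nIT mulr1.
by rewrite -(mulrA _ G) GG mulr1 TI subrr.
Qed.

Lemma twisted0 : twisted 0 = sign_mx A n l.
Proof.
have inv0 : fps_inv T 0 = 1.
  by rewrite -[LHS]/(\sum_(k < 1) ((1 - T) ^+ k) 0%N) big_ord1 expr0.
rewrite /twisted fpsME big_ord1 fps_Mconst T0 mul1r.
by rewrite -[RHS]mulr1 -inv0.
Qed.

End YangianToReflection.

Section FreeSpan.
Variables (K : comNzRingType) (X : choiceType).

Lemma freeAlg_word (s : seq X) :
  << FMonom s >> = \prod_(x <- s) freeAlg_gen K x :> freeAlg K X.
Proof.
elim: s => [|x s IHs].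
  by rewrite big_nil -[RHS]/(<< fmone X >>) fmoneE.
rewrite big_cons -IHs /freeAlg_gen [RHS]malgM_def fgmulUU mulr1; congr << _ >>.
by apply/val_inj; rewrite /= fmM fmU.
Qed.

Lemma freeAlg_span (x : freeAlg K X) : exists s : seq (K * seq X),
  x = \sum_(cw <- s) cw.1 *: \prod_(a <- cw.2) freeAlg_gen K a.
Proof.
exists [seq (x@_m, fmonom_val m) | m : {fmonom X} <- finmap.enum_fset (msupp x)].
rewrite big_map /= {1}[x]monalgE; apply: eq_bigr => m _.
rewrite -freeAlg_word fmK; apply/malgP => k.
by rewrite mcoeffZ !mcoeffU mulrnAr mulr1.
Qed.

End FreeSpan.

(** * Universal properties of the two presentations, and the homomorphism *)

Section Presented.
Variables (K : comNzRingType) (n : nat).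

Lemma yangian_T_eqn i j a b : yangian_eqn (yangian_T K n) i j a b = 0.
Proof.
rewrite -(map_yangian_eqn (quotAlg_pi (@yangian_proper K n))).
apply/fpsP => p; apply/fpsP => q; rewrite !fps_mapE.
rewrite -[RHS](rmorph0 (quotAlg_pi (@yangian_proper K n))).
apply: (quotAlg_piP _ _ _).2; rewrite subr0; apply: ideal_gen.
by exists i, j, a, b, p, q.
Qed.

Lemma yangian_T0 : yangian_T K n 0 = 1.
Proof. by rewrite /yangian_T fps_mapE map_scalar_mx rmorph1. Qed.

Lemma reflection_B_eqn l : reflection_eqn (reflection_B K n l) = 0.
Proof.
rewrite -(map_reflection_eqn (quotAlg_pi (@reflection_proper K n l))).
apply/fpsP => p; apply/fpsP => q; apply/matrixP => i j; rewrite !fps_mapE [LHS]mxE [RHS]mxE.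
rewrite -[RHS](rmorph0 (quotAlg_pi (@reflection_proper K n l))).
apply: (quotAlg_piP _ _ _).2; rewrite subr0; apply: ideal_gen.
by left; exists p, q, i, j.
Qed.

Lemma reflection_B_unitarity l : unitarity_eqn (reflection_B K n l) = 0.
Proof.
rewrite -(map_unitarity_eqn (quotAlg_pi (@reflection_proper K n l))).
apply/fpsP => p; apply/matrixP => i j; rewrite !fps_mapE [LHS]mxE [RHS]mxE.
rewrite -[RHS](rmorph0 (quotAlg_pi (@reflection_proper K n l))).
apply: (quotAlg_piP _ _ _).2; rewrite subr0; apply: ideal_gen.
by right; exists p, i, j.
Qed.

Lemma reflection_B0 l : reflection_B K n l 0 = sign_mx _ n l.
Proof. by rewrite /reflection_B fps_mapE; apply: map_sign_mx. Qed.

Section Lift.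
Variables (A : nzRingType) (iota : {rmorphism K -> A}).
Hypothesis iotaC : forall c a, iota c * a = a * iota c.

Definition gen_value (T : fps 'M[A]_n) (g : nat * 'I_n * 'I_n) : A :=
  T g.1.1.+1 g.1.2 g.2.

Lemma free_ser_lift (F : {rmorphism genFree K n -> A}) (T : fps 'M[A]_n)
    (C : 'M[genFree K n]_n) :
  (forall x, F (freeAlg_gen K x) = gen_value T x) -> map_mx F C = T 0 ->
  fps_map (map_mx F) (free_ser C) = T.
Proof.
by move=> FT C0; apply/fpsP => -[|r] //=; apply/matrixP => i j; rewrite !mxE FT.
Qed.

Lemma map_presented (S : set (genFree K n)) (S_proper : ~ two_sided_ideal S 1)
    (f : {rmorphism quotAlg S_proper -> A}) (C : 'M[genFree K n]_n) (T : fps 'M[A]_n) :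
  (forall x, f (quotAlg_pi S_proper (freeAlg_gen K x)) = gen_value T x) ->
  map_mx f (map_mx (quotAlg_pi S_proper) C) = T 0 ->
  fps_map (map_mx f) (fps_map (map_mx (quotAlg_pi S_proper)) (free_ser C)) = T.
Proof.
by move=> fT C0; apply/fpsP => -[|r] //=; apply/matrixP => i j; rewrite !mxE fT.
Qed.

Lemma yangian_lift (T : fps 'M[A]_n) : T 0 = 1 ->
    (forall i j a b, yangian_eqn T i j a b = 0) ->
  exists2 f : {rmorphism yangian K n -> A},
    fps_map (map_mx f) (yangian_T K n) = T & forall c x, f (c *: x) = iota c * f x.
Proof.
move=> T0 TY; pose F := freeAlg_lift_rmorphism (gen_value T) iotaC.
have FT : fps_map (map_mx F) (free_ser 1%:M) = T.
  apply: free_ser_lift; first exact: freeAlg_lift_gen.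
  by rewrite T0 map_scalar_mx rmorph1.
have F0 x : yangian_rels x -> F x = 0.
  move=> [i [j [a [b [p [q ->]]]]]].
  rewrite -[LHS]/(fps_map (fps_map F) (yangian_eqn (free_ser 1%:M) i j a b) p q).
  by rewrite (map_yangian_eqn F) FT TY.
have [f fT fZ] := presented_lift iotaC (@yangian_proper K n) F0.
exists f => //; apply: map_presented => //.
by rewrite T0 !map_scalar_mx !rmorph1.
Qed.

Lemma reflection_lift l (T : fps 'M[A]_n) : T 0 = sign_mx A n l ->
    reflection_eqn T = 0 -> unitarity_eqn T = 0 ->
  exists2 f : {rmorphism reflection_algebra K n l -> A},
    fps_map (map_mx f) (reflection_B K n l) = T & forall c x, f (c *: x) = iota c * f x.
Proof.
move=> T0 TR TU; pose F := freeAlg_lift_rmorphism (gen_value T) iotaC.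
have FT : fps_map (map_mx F) (free_ser (sign_mx _ n l)) = T.
  apply: free_ser_lift; first exact: freeAlg_lift_gen.
  by rewrite T0 (map_sign_mx F).
have F0 x : reflection_rels l x -> F x = 0.
  case=> [[p [q [i [j ->]]]]|[r [i [j ->]]]].
    transitivity (fps_map (fps_map (map_mx F))
      (reflection_eqn (free_ser (sign_mx _ n l))) p q i j).
      by rewrite !fps_mapE [RHS]mxE.
    by rewrite (map_reflection_eqn F) FT TR mxE.
  transitivity (fps_map (map_mx F)
    (unitarity_eqn (free_ser (sign_mx _ n l))) r i j).
    by rewrite !fps_mapE [RHS]mxE.
  by rewrite (map_unitarity_eqn F) FT TU mxE.
have [f fT fZ] := presented_lift iotaC (@reflection_proper K n l) F0.
exists f => //; apply: map_presented => //.
by rewrite T0 map_sign_mx; apply: map_sign_mx.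
Qed.

End Lift.

Lemma reflection_to_yangian l :
  exists phi : {lrmorphism reflection_algebra K n l -> yangian K n},
    fps_map (map_mx phi) (reflection_B K n l)
      = twisted l (yangian_T K n).
Proof.
have iotaC c (a : yangian K n) : in_alg (yangian K n) c * a = a * in_alg (yangian K n) c.
  by rewrite /= mulr_algl mulr_algr.
have [f fB fZ] := reflection_lift iotaC (twisted0 l yangian_T0)
  (reflection_twisted l yangian_T_eqn yangian_T0) (unitarity_twisted l yangian_T0).
have fZ' : scalable f by move=> c x; rewrite fZ /= mulr_algl.
pose fS := GRing.isScalable.Build K _ _ *:%R f fZ'.
pose phi : {lrmorphism reflection_algebra K n l -> yangian K n} := HB.pack
  (GRing.RMorphism.sort f) (GRing.RMorphism.class f) fS.
by exists phi.
Qed.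

End Presented.

(** * Spans of words, the weight filtration, and reordering modulo lower weight *)

Section WordSpan.
Variables (K : comNzRingType) (A : algType K) (L : Type) (b : L -> A).
Implicit Types (w : seq L) (s : seq (K * seq L)) (P Q R : pred (seq L)).

Definition word w : A := \prod_(g <- w) b g.

Definition word_comb s : A := \sum_(cw <- s) cw.1 *: word cw.2.

Definition word_span P (x : A) : Prop :=
  exists2 s, all (fun cw => P cw.2) s & x = word_comb s.

Lemma word_cat w w' : word (w ++ w') = word w * word w'.
Proof. exact: big_cat. Qed.

Lemma word_cons a w : word (a :: w) = b a * word w.
Proof. exact: big_cons. Qed.

Lemma word_nil : word [::] = 1.
Proof. exact: big_nil. Qed.

Lemma word_span_word P w : P w -> word_span P (word w).
Proof.
by move=> Pw; exists [:: (1, w)]; rewrite /word_comb ?big_seq1 ?scale1r //= Pw.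
Qed.

Lemma word_span0 P : word_span P 0.
Proof. by exists [::]; rewrite // /word_comb big_nil. Qed.

Lemma word_spanD P x y : word_span P x -> word_span P y -> word_span P (x + y).
Proof.
move=> [s Ps ->] [s' Ps' ->]; exists (s ++ s'); first by rewrite all_cat Ps.
by rewrite /word_comb big_cat.
Qed.

Lemma word_spanZ P c x : word_span P x -> word_span P (c *: x).
Proof.
move=> [s Ps ->]; exists [seq (c * cw.1, cw.2) | cw <- s]; first by rewrite all_map.
by rewrite /word_comb big_map scaler_sumr; apply: eq_bigr => cw _; rewrite scalerA.
Qed.

Lemma word_spanN P x : word_span P x -> word_span P (- x).
Proof. by rewrite -scaleN1r; apply: word_spanZ. Qed.

Lemma word_spanB P x y : word_span P x -> word_span P y -> word_span P (x - y).
Proof. by move=> Px Py; apply/word_spanD/word_spanN. Qed.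

Lemma word_span_sum P (I : Type) (r : seq I) (p : pred I) (F : I -> A) :
  (forall i, p i -> word_span P (F i)) -> word_span P (\sum_(i <- r | p i) F i).
Proof. by move=> PF; apply: big_ind => //; [apply: word_span0 | apply: word_spanD]. Qed.

Lemma word_spanMn P x m : word_span P x -> word_span P (x *+ m).
Proof.
by move=> Px; elim: m => [|m IHm]; rewrite ?mulrS; [apply: word_span0|apply: word_spanD].
Qed.

Lemma word_span_trans P Q x : word_span P x ->
  (forall w, P w -> word_span Q (word w)) -> word_span Q x.
Proof.
move=> [s Ps ->] PQ; elim: s Ps => [|cw s IHs] /=.
  by rewrite /word_comb big_nil => _; apply: word_span0.
case/andP=> Pcw Ps; rewrite /word_comb big_cons; apply: word_spanD (IHs Ps).
exact/word_spanZ/PQ.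
Qed.

Lemma word_span_sub P Q x : word_span P x -> {subset P <= Q} -> word_span Q x.
Proof. by move=> Px PQ; apply: word_span_trans Px _ => w /PQ; apply: word_span_word. Qed.

Lemma word_spanM P Q R x y : word_span P x -> word_span Q y ->
  (forall w w', P w -> Q w' -> R (w ++ w')) -> word_span R (x * y).
Proof.
move=> [s Ps ->] Qy PQR; rewrite /word_comb mulr_suml.
elim: s Ps => [|[c w] s IHs] /=; first by rewrite big_nil => _; apply: word_span0.
case/andP=> Pw Ps; rewrite big_cons; apply: word_spanD (IHs Ps).
rewrite -scalerAl; apply: word_spanZ; case: Qy => s' Qs' ->.
rewrite /word_comb mulr_sumr.
elim: s' Qs' {IHs} => [|[c' w'] s' IHs'] /=; first by rewrite big_nil => _; apply: word_span0.
case/andP=> Qw Qs; rewrite big_cons; apply: word_spanD (IHs' Qs).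
by rewrite -scalerAr -word_cat; apply/word_spanZ/word_span_word/PQR.
Qed.

Variable wt : L -> nat.

Definition weight w := (\sum_(g <- w) wt g)%N.
(** With the strict inequality, level 0 spans only 0, which is the base of the final induction, and
    [below d] is directly the lower-order part of weight d. *)
Definition below d : pred (seq L) := fun w => (weight w < d)%N.

Lemma weight_cat w w' : weight (w ++ w') = (weight w + weight w')%N.
Proof. exact: big_cat. Qed.

Lemma weight_cons a w : weight (a :: w) = (wt a + weight w)%N.
Proof. exact: big_cons. Qed.

Lemma weight_nil : weight [::] = 0.
Proof. exact: big_nil. Qed.

Lemma span_below_le d d' x : (d <= d')%N ->
  word_span (below d) x -> word_span (below d') x.
Proof.
by move=> dd Vx; apply: word_span_sub Vx _ => w; rewrite !unfold_in => /leq_trans ->.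
Qed.

Lemma span_belowM d d' x y : word_span (below d.+1) x -> word_span (below d'.+1) y ->
  word_span (below (d + d').+1) (x * y).
Proof.
move=> Vx Vy; apply: word_spanM Vx Vy _ => w w'.
by rewrite /below weight_cat !ltnS => ? ?; apply: leq_add.
Qed.

Hypothesis commutator_below : forall g h,
  word_span (below (wt g + wt h)) (b g * b h - b h * b g).

Lemma word_below_cat u v x d : word_span (below d) x ->
  word_span (below (weight u + d + weight v)) (word u * x * word v).
Proof.
case=> s Vs ->; exists [seq (cw.1, u ++ cw.2 ++ v) | cw <- s].
  rewrite all_map; apply: sub_all Vs => -[c w]; rewrite /below /= !weight_cat.
  by rewrite addnA ltn_add2r ltn_add2l.
rewrite /word_comb big_map mulr_sumr mulr_suml; apply: eq_bigr => -[c w] _ /=.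
by rewrite !word_cat -scalerAr -scalerAl mulrA.
Qed.

(** The letter a passes the letters of u one at a time, and each transposition costs a commutator of
    lower weight inside an otherwise unchanged word. *)
Lemma word_insert a u v :
  word_span (below (weight (a :: u ++ v))) (word (a :: u ++ v) - word (u ++ a :: v)).
Proof.
elim: u => [|x u IHu]; first by rewrite subrr; apply: word_span0.
rewrite -[word _](subrK (word (x :: a :: u ++ v))) -addrA; apply: word_spanD.
  have := @word_below_cat [::] (u ++ v) _ _ (commutator_below a x).
  by rewrite word_nil mul1r mulrBl -!mulrA /= !word_cons !weight_cons weight_nil add0n addnA.
have := @word_below_cat [:: x] [::] _ _ IHu.
rewrite word_nil mulr1 mulrBr /= !word_cons word_nil mulr1.
by rewrite !weight_cons weight_nil !addn0 addnCA.
Qed.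

End WordSpan.

Section WordPermutation.
Variables (K : comNzRingType) (A : algType K) (L : eqType) (b : L -> A) (wt : L -> nat).
Hypothesis commutator_below : forall g h,
  word_span b (below wt (wt g + wt h)) (b g * b h - b h * b g).

(** The first letter a of w occurs in w' as u ++ a :: v. The rest of w is reordered into u ++ v by
    induction, and then a is moved to its place. *)
Lemma word_perm w w' : perm_eq w w' ->
  word_span b (below wt (weight wt w)) (word b w - word b w').
Proof.
elim: w w' => [|a w IHw] w'.
  by rewrite perm_sym => /perm_nilP ->; rewrite subrr; apply: word_span0.
move=> ww'; have aw' : a \in w' by rewrite -(perm_mem ww') mem_head.
case/splitPr: aw' ww' => u v; rewrite perm_sym -cat1s perm_catCA /= perm_cons => uvw.
rewrite -[word b _](subrK (word b (a :: u ++ v))) -addrA; apply: word_spanD.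
  have := @word_below_cat _ _ _ b wt [:: a] [::] _ _ (IHw (u ++ v) _).
  rewrite word_nil mulr1 mulrBr !word_cons word_nil mulr1.
  by rewrite !weight_cons weight_nil !addn0 => H; apply: H; rewrite perm_sym.
have -> : weight wt (a :: w) = weight wt (a :: u ++ v).
  by rewrite /weight !big_cons (perm_big _ uvw).
exact: word_insert.
Qed.

End WordPermutation.

(** * Commutators in the reflection algebra drop the weight *)

Lemma expand_central (Z : pzRingType) (t t' c Q Q' U V : Z) :
  (forall z, z * t' = t' * z) -> (forall z, z * c = c * z) ->
  (t * Q - c * U) * (t' * Q' - c * V)
    = t * (t' * (Q * Q')) - c * (t * (Q * V)) - (c * (t' * (U * Q')) - c * (c * (U * V))).
Proof.
move=> tC cC.
have mulACA (w x y z : Z) : (forall z', z' * y = y * z') ->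
    w * x * (y * z) = w * (y * (x * z)).
  by move=> yC; rewrite !mulrA -(mulrA w) yC !mulrA.
by rewrite mulrBl !mulrBr !(mulACA _ _ t') // !(mulACA _ _ c) // (mulrA t c) cC -!mulrA.
Qed.

(** With s = u^-1 v^-1 (u - v), t = u^-1 v^-1 (u + v) and c = u^-1 v^-1, expanding the reflection
    equation isolates the commutator. It is multiplied by s t, of degree 2 in the inverse variables,
    while every other term carries c s, c t or c c, of degree 3 or 4. This surplus is the source of
    the weight drop. *)
Lemma reflection_commutator (Z : pzRingType) (s t c P X Y : Z) :
  (forall z, z * s = s * z) -> (forall z, z * t = t * z) -> (forall z, z * c = c * z) ->
  (s - c * P) * X * (t - c * P) * Y = Y * (t - c * P) * X * (s - c * P) ->
  s * (t * (X * Y - Y * X)) = c * (s * (X * (P * Y)))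
    + (c * (t * (P * X * Y)) - c * (c * (P * X * (P * Y))))
    - (c * (t * (Y * (X * P))) + (c * (s * (Y * P * X)) - c * (c * (Y * P * (X * P))))).
Proof.
move=> sC tC cC.
have left U z : (z - c * P) * U = z * U - c * (P * U) by rewrite mulrBl mulrA.
have right U z : (forall y, y * z = z * y) -> U * (z - c * P) = z * U - c * (U * P).
  by move=> zC; rewrite mulrBr zC mulrA cC mulrA.
rewrite -[X in X = _ -> _]mulrA -[X in _ = X -> _]mulrA !left !right //.
rewrite !expand_central //.
have ts z : t * (s * z) = s * (t * z) by rewrite !mulrA -tC.
rewrite ts mulrBr mulrBr.
set a1 := s * _; set a2 := c * _; set a3 := (_ - _); set a4 := s * _.
set a5 := c * _; set a6 := (_ - _) => E.
have {}E : a1 - (a2 + (c * (t * (P * X * Y)) - c * (c * (P * X * (P * Y))))) =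
    a4 - (a5 + (c * (s * (Y * P * X)) - c * (c * (Y * P * (X * P))))).
  by rewrite opprD addrA [X in _ = a4 + X]opprD [RHS]addrA; exact: E.
move: (a2 + _) (a5 + _) E => z z' E.
have -> : a1 = a4 - z' + z by rewrite -E subrK.
by rewrite addrC !addrA addNr add0r addrC.
Qed.

Definition letter n := (nat * 'I_n * 'I_n)%type.
Definition order n (g : letter n) : nat := g.1.1.+1.

Section ReflectionWords.
Variables (K : comNzRingType) (A : algType K) (n l : nat) (B : fps 'M[A]_n).
Hypothesis B0 : B 0 = sign_mx A n l.
Local Notation b := (gen_value B).
Local Notation V d := (word_span b (below (@order n) d)).
Local Notation Z := (fps (fps 'M[A]_(n * n))).

(** The coefficient of u^-p v^-q has weight at most p + q - k. When p + q < k the truncated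
    subtraction gives level 0, so that the coefficient must vanish. *)
Definition drop_order k (X : Z) := forall p q x y, V (p + q + 1 - k)%N (X p q x y).

Lemma V_scalar c d : V d.+1 (c%:A).
Proof.
by rewrite -(word_nil b); apply/word_spanZ/word_span_word; rewrite /below weight_nil.
Qed.

Lemma entry_order p i j : V p.+1 (B p i j).
Proof.
case: p => [|p].
  rewrite B0 -map_sign_alg mxE; exact: V_scalar.
have -> : B p.+1 i j = word b [:: (p, i, j)] by rewrite word_cons word_nil mulr1.
by apply: word_span_word; rewrite /below weight_cons weight_nil addn0.
Qed.

Lemma drop_orderB k X Y : drop_order k X -> drop_order k Y -> drop_order k (X - Y).
Proof.
move=> dX dY p q x y; rewrite -[fps_coef _ q]/(X p q - Y p q) !mxE; exact: word_spanB.
Qed.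

Lemma drop_orderD k X Y : drop_order k X -> drop_order k Y -> drop_order k (X + Y).
Proof.
move=> dX dY p q x y; rewrite -[fps_coef _ q]/(X p q + Y p q) mxE; exact: word_spanD.
Qed.

Lemma drop_order_le k k' X : (k' <= k)%N -> drop_order k X -> drop_order k' X.
Proof. by move=> kk dX p q x y; apply: span_below_le (dX p q x y); lia. Qed.

Lemma drop_order_u k X : drop_order k X -> drop_order k.+1 (u_inv _ * X).
Proof.
move=> dX [|p] q x y; rewrite u_invE; first by rewrite fps0E mxE; apply: word_span0.
by apply: span_below_le (dX p q x y); lia.
Qed.

Lemma drop_order_v k X : drop_order k X -> drop_order k.+1 (v_inv _ * X).
Proof.
move=> dX p [|q] x y; rewrite v_invE; first by rewrite mxE; apply: word_span0.
by apply: span_below_le (dX p q x y); lia.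
Qed.

Lemma drop_orderM X Y : drop_order 0 X -> drop_order 0 Y -> drop_order 0 (X * Y).
Proof.
move=> dX dY p q x y; rewrite fpsME fps_sumE summxE; apply: word_span_sum => i _.
rewrite fpsME summxE; apply: word_span_sum => j _.
rewrite mxE; apply: word_span_sum => z _.
have := dX i j x z; have := dY (p - i)%N (q - j)%N z y.
rewrite !subn0 !addn1 => dy dx; apply: span_below_le (span_belowM dx dy).
by have := ltn_ord i; have := ltn_ord j; lia.
Qed.

Lemma drop_order_B1 : drop_order 0 (B1 B).
Proof.
move=> p q x y; case: (mxtens_indexP x) => i a; case: (mxtens_indexP y) => j c.
rewrite subn0; case: q => [|q]; last by rewrite mxE; apply: word_span0.
rewrite [fps_coef _ 0%N]/(mx_in1 (B p)) in1E addn0 addn1; exact/word_spanMn/entry_order.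
Qed.

Lemma drop_order_B2 : drop_order 0 (B2 B).
Proof.
move=> p q x y; case: (mxtens_indexP x) => i a; case: (mxtens_indexP y) => j c.
rewrite subn0; case: p => [|p]; last by rewrite mxE; apply: word_span0.
rewrite [fps_coef _ q]/(mx_in2 (B q)) in2E add0n addn1; exact/word_spanMn/entry_order.
Qed.

Lemma drop_order_flip : drop_order 0 (ser_c (flip_mx A n)).
Proof.
move=> p q x y; case: (mxtens_indexP x) => i a; case: (mxtens_indexP y) => j c.
rewrite subn0 addn1; case: p => [|p]; last by rewrite mxE; apply: word_span0.
case: q => [|q]; last by rewrite mxE; apply: word_span0.
rewrite [fps_coef _ 0%N]/(flip_mx A n) flipE; apply: word_spanMn.
by have := V_scalar 1 0; rewrite scale1r.
Qed.

Definition b_comm p q i j a c : A := B p i j * B q a c - B q a c * B p i j.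

Hypothesis B_reflection : reflection_eqn B = 0.

(** Products of B_1, B_2 and P drop nothing, and each factor u^-1 or v^-1 drops one; so 3 is the
    smallest drop among the terms c s, c t and c c. *)
Lemma commutator_drop (s := v_inv _ - u_inv _) (t := v_inv _ + u_inv _) :
  drop_order 3 (s * (t * (B1 B * B2 B - B2 B * B1 B))).
Proof.
pose c := u_inv 'M[A]_(n * n) * v_inv _; pose P := ser_c (flip_mx A n).
have uC z : z * u_inv 'M[A]_(n * n) = u_inv _ * z by apply: u_inv_comm.
have vC z : z * v_inv 'M[A]_(n * n) = v_inv _ * z by apply: v_inv_comm.
have cC z : z * c = c * z by rewrite /c mulrA uC -!mulrA vC.
have sC z : z * s = s * z by rewrite /s mulrBr mulrBl uC vC.
have tC z : z * t = t * z by rewrite /t mulrDr mulrDl uC vC.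
have d1 := drop_order_B1; have d2 := drop_order_B2; have dP := drop_order_flip.
have ds k z : drop_order k z -> drop_order k.+1 (s * z).
  move=> dz; have -> : s * z = v_inv _ * z - u_inv _ * z by apply: mulrBl.
  by apply: drop_orderB; [apply: drop_order_v | apply: drop_order_u].
have dt k z : drop_order k z -> drop_order k.+1 (t * z).
  move=> dz; have -> : t * z = v_inv _ * z + u_inv _ * z by apply: mulrDl.
  by apply: drop_orderD; [apply: drop_order_v | apply: drop_order_u].
have dc k z : drop_order k z -> drop_order k.+2 (c * z).
  move=> dz; have -> : c * z = u_inv _ * (v_inv _ * z) by rewrite mulrA.
  exact/drop_order_u/drop_order_v.
have dcs z : drop_order 0 z -> drop_order 3 (c * (s * z)).
  by move=> dz; apply/dc/ds.
have dct z : drop_order 0 z -> drop_order 3 (c * (t * z)).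
  by move=> dz; apply/dc/dt.
have dcc z : drop_order 0 z -> drop_order 3 (c * (c * z)).
  by move=> dz; apply: (@drop_order_le 4); last exact/dc/dc.
rewrite (@reflection_commutator _ s t c P _ _ sC tC cC); last first.
  by apply/eqP; rewrite -subr_eq0; apply/eqP.
have dXY X Y : drop_order 0 X -> drop_order 0 Y -> drop_order 0 (X * Y).
  exact: drop_orderM.
apply: drop_orderB; apply: drop_orderD.
- exact: dcs _ (dXY _ _ d1 (dXY _ _ dP d2)).
- exact: drop_orderB (dct _ (dXY _ _ (dXY _ _ dP d1) d2))
    (dcc _ (dXY _ _ (dXY _ _ dP d1) (dXY _ _ dP d2))).
- exact: dct _ (dXY _ _ d2 (dXY _ _ d1 dP)).
exact: drop_orderB (dcs _ (dXY _ _ (dXY _ _ d2 dP) d1))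
  (dcc _ (dXY _ _ (dXY _ _ d2 dP) (dXY _ _ d1 dP))).
Qed.

Let comm_entry p q i j a c :
  (B1 B * B2 B - B2 B * B1 B) p q (mxtens_index (i, a)) (mxtens_index (j, c))
    = b_comm p q i j a c.
Proof.
rewrite -[fps_coef _ q]/((B1 B * B2 B) p q - (B2 B * B1 B) p q).
by rewrite [LHS]mxE [X in _ + X]mxE B12E B21E.
Qed.

(** Here s t = v^-2 - u^-2. Reading the coefficient at [q.+2] makes the v^-2 term return X p q. *)
Let square_shift (X : Z) p q : let s := v_inv _ - u_inv _ in let t := v_inv _ + u_inv _ in
  (s * (t * X)) p q.+2 = X p q - (if p is p'.+2 then X p' q.+2 else 0).
Proof.
move=> s t; have tE Y p' q' : (t * Y) p' q' = (v_inv _ * Y) p' q' + (u_inv _ * Y) p' q'.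
  by rewrite mulrDl.
have sE Y p' q' : (s * Y) p' q' = (v_inv _ * Y) p' q' - (u_inv _ * Y) p' q'.
  by rewrite mulrBl.
rewrite sE v_invE tE v_invE !u_invE.
case: p => [|p]; first by rewrite !fps0E addr0.
rewrite tE v_invE u_invE.
case: p => [|p]; first by rewrite fps0E addr0 subr0 addrK.
by rewrite opprD addrA addrK.
Qed.

(** Modulo weight below p + q, the commutator of b^(p) and b^(q) equals that of b^(p-2) and b^(q+2):
    two orders can be moved from the first entry to the second. *)
Lemma commutator_step p q i j a c :
  V (p + q) (b_comm p q i j a c - (if p is p'.+2 then b_comm p' q.+2 i j a c else 0)).
Proof.
have := commutator_drop p q.+2 (mxtens_index (i, a)) (mxtens_index (j, c)).
rewrite square_shift [X in word_span _ _ X -> _]mxE [X in _ + X]mxE comm_entry.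
have -> : (p + q.+2 + 1 - 3 = p + q)%N by lia.
have zeroE x y : (0 : 'M[A]_(n * n)) x y = 0 by rewrite mxE.
by case: p => [|[|p]]; rewrite ?comm_entry ?zeroE.
Qed.

Lemma b_comm0 q i j a c : b_comm 0 q i j a c = 0.
Proof. by rewrite /b_comm B0 sign_central subrr. Qed.

Lemma b_comm_below p q i j a c : V (p + q) (b_comm p q i j a c).
Proof.
(* Descent by 2 in p ends at p = 0, where B^(0) = G is scalar, or at p = 1, where the shifted term
   is absent. *)
elim/ltn_ind: p q => -[|p] IHp q; first by rewrite b_comm0; apply: word_span0.
have := commutator_step p.+1 q i j a c; case: p IHp => [|p] IHp; first by rewrite subr0.
move=> H; rewrite -[b_comm _ _ _ _ _ _](subrK (b_comm p q.+2 i j a c)).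
apply: word_spanD => //.
by have := IHp p (leqnSn _) q.+2; congr (word_span _ (below _ _) _); lia.
Qed.

Lemma commutator_below g h : V (order g + order h) (b g * b h - b h * b g).
Proof. exact: b_comm_below. Qed.

End ReflectionWords.

(* The unitarity condition in degree r reads
   (eps_j + (-1)^r eps_i) b_ij^(r) = (products of lower generators),
   so the generators with eps_i eps_j <> (-1)^(r+1) are redundant. *)
Definition good_letter n l (g : letter n) : bool :=
  ((n - l <= g.1.2)%N (+) (n - l <= g.2)%N) (+) odd (order g).

(** * Elimination of the redundant generators by unitarity *)

Section SignMatrix.
Variables (A : pzRingType) (n l : nat).

Lemma mul_sign_mx (M : 'M[A]_n) i j :
  (sign_mx A n l * M) i j = (-1) ^+ (n - l <= i)%N * M i j.
Proof.
by rewrite -[_ * M]/(diag_mx _ *m M) mul_diag_mx !mxE ltnNge; case: leqP.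
Qed.

Lemma mulmx_sign (M : 'M[A]_n) i j :
  (M * sign_mx A n l) i j = M i j * (-1) ^+ (n - l <= j)%N.
Proof.
by rewrite -[M * _]/(M *m diag_mx _) mul_mx_diag !mxE ltnNge; case: leqP.
Qed.

Lemma mul_sign (M : 'M[A]_n) r i j : ((-1) ^+ r * M) i j = (-1) ^+ r * M i j.
Proof.
rewrite -signr_odd -[in RHS]signr_odd !mulr_sign.
by case: odd; rewrite ?mxE.
Qed.

End SignMatrix.

Section GoodWords.
Variables (K : numFieldType) (A : algType K) (n l : nat) (B : fps 'M[A]_n).
Hypothesis B0 : B 0 = sign_mx A n l.
Hypothesis B_unitarity : unitarity_eqn B = 0.
Local Notation b := (gen_value B).
Local Notation weight := (weight (@order n)).

Definition good_upto d : pred (seq (letter n)) :=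
  fun w => all (good_letter l) w && (weight w <= d)%N.

Lemma good_uptoM d e x y : word_span b (good_upto d) x ->
  word_span b (good_upto e) y -> word_span b (good_upto (d + e)) (x * y).
Proof.
move=> Vx Vy; apply: word_spanM Vx Vy _ => w w' /andP[gw dw] /andP[gw' ew'].
by rewrite /good_upto all_cat gw gw' weight_cat leq_add.
Qed.

Lemma bad_letter_lower r i j : ~~ good_letter l (r, i, j) ->
  exists c : K, B r.+1 i j
    = c *: \sum_(s < r) (-1) ^+ (r - s) * (B s.+1 * B (r - s)%N) i j.
Proof.
move=> bad.
have := congr1 (fun f : fps 'M[A]_n => f r.+1 i j) B_unitarity.
have -> : (0 : fps 'M[A]_n) r.+1 i j = 0 by rewrite mxE.
rewrite -[unitarity_eqn B]/(B * fps_neg B - 1).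
have -> : (B * fps_neg B - 1) r.+1 = (B * fps_neg B) r.+1.
  by rewrite fpsDE fpsNE fps1E subr0.
rewrite fpsME big_ord_recr big_ord_recl.
rewrite (eq_bigr (fun s : 'I_r => (-1) ^+ (r - s) * (B s.+1 * B (r - s)%N))); last first.
  move=> s _; rewrite -[LHS]/(B s.+1 * fps_neg B (r.+1 - s.+1)%N) fps_negE subSS.
  by rewrite -signr_odd !mulr_sign; case: odd; rewrite ?mulrN.
pose y : A := \sum_(s < r) (-1) ^+ (r - s) * (B s.+1 * B (r - s)%N) i j.
rewrite !fps_negE -/y.
rewrite subn0 subnn expr0 mul1r B0 mxE mxE mul_sign_mx mulmx_sign mul_sign.
have -> : (\sum_(s < r) (-1) ^+ (r - s) * (B s.+1 * B (r - s)%N)) i j = y.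
  by rewrite summxE; apply: eq_bigr => s _; rewrite mul_sign.
rewrite mulrA -exprD.
(* For a redundant letter these signs agree, so the two extreme summands, in which one factor is
   B^(0) = G, add up to 2 eps_j b_ij instead of cancelling. *)
have -> : (-1) ^+ ((n - l <= i) + r.+1) = (-1) ^+ (n - l <= j)%N :> A.
  rewrite -signr_odd oddD oddb; congr (_ ^+ nat_of_bool _); move: bad.
  rewrite -[good_letter _ _]/(((n - l <= i)%N (+) (n - l <= j)%N) (+) odd r.+1).
  by move: (n - l <= i)%N (n - l <= j)%N (odd r.+1) => [] [] [].
set e := (n - l <= j)%N => H.
(* The relation is y = - 2 eps_j b_ij, and eps_j is its own inverse. *)
exists (- ((-1) ^+ e / 2%:R)).
have -> : y = - ((-1) ^+ e * B r.+1 i j *+ 2).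
  have sC : B r.+1 i j * (-1) ^+ e = (-1) ^+ e * B r.+1 i j.
    by rewrite mulr_sign; case: e {H}; rewrite ?mulrN1 ?mulr1.
  by apply/eqP; rewrite -addr_eq0 -H sC mulr2n addrCA addrA.
rewrite scaleNr scalerN opprK -scalerMnr scalerMnl -[X in X *: _]mulr_natr.
rewrite divfK; last by rewrite (pnatr_eq0 K 2).
by case: e {H}; rewrite ?expr1 ?scaleN1r ?mulN1r ?opprK ?expr0 ?scale1r ?mul1r.
Qed.

(** Replacing a redundant letter of degree r+1 yields products of degrees s+1 and r-s, so the total
    weight is not raised while both factors have smaller degree; strong induction on the degree
    therefore keeps the bound r. *)
Lemma good_span_entry r i j : word_span b (good_upto r) (B r i j).
Proof.
elim/ltn_ind: r i j => -[|r] IHr i j.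
  rewrite B0 -map_sign_alg mxE /= -(word_nil b); apply: word_spanZ.
  by apply: word_span_word; rewrite /good_upto weight_nil.
have [good|bad] := boolP (good_letter l (r, i, j)).
  have -> : B r.+1 i j = word b [:: (r, i, j)] by rewrite word_cons word_nil mulr1.
  by apply: word_span_word; rewrite /good_upto /= good weight_cons weight_nil addn0 leqnn.
have [c ->] := bad_letter_lower bad; apply/word_spanZ/word_span_sum => s _.
rewrite -signr_odd mulr_sign; case: odd; [apply: word_spanN|];
  rewrite mxE; apply: word_span_sum => k _.
all: have -> : r.+1 = (s.+1 + (r - s))%N by have := ltn_ord s; lia.
all: by apply: good_uptoM; apply: IHr; have := ltn_ord s; lia.
Qed.

Lemma good_span_word w : word_span b (good_upto (weight w)) (word b w).
Proof.
elim: w => [|[[r i] j] w IHw].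
  by apply: word_span_word; rewrite /good_upto leqnn.
by rewrite word_cons weight_cons; apply: good_uptoM IHw; apply: good_span_entry.
Qed.

End GoodWords.

(** * Rings of linear operators and the Weyl relations *)

Section Endomorphisms.
Variables (K : comNzRingType) (V : lmodType K).

(** Linearity is stored as a boolean, so that operators form a subtype of functions and inherit
    choice, and equality is pointwise. *)
Record endo := Endo { endo_fun :> V -> V; _ : `[< linear endo_fun >] }.

HB.instance Definition _ := [isSub for endo_fun].
HB.instance Definition _ := [Choice of endo by <:].

Lemma endoP (f g : endo) : (forall v, f v = g v) -> f = g.
Proof. by move=> fg; apply/val_inj/funext. Qed.

Lemma endo_linear (f : endo) : linear f.
Proof. by case: f => f /= /asboolP. Qed.

Lemma endoD (f : endo) u v : f (u + v) = f u + f v.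
Proof. by rewrite -[u]scale1r endo_linear !scale1r. Qed.

Lemma endoZ (f : endo) c v : f (c *: v) = c *: f v.
Proof.
have f0 : f 0 = 0 by apply: (addrI (f 0)); rewrite -endoD !addr0.
by rewrite -[c *: v]addr0 endo_linear f0 addr0.
Qed.

Fact endo_zero_linear : `[< linear (fun _ : V => 0 : V) >].
Proof. by apply/asboolP => c u v; rewrite scaler0 addr0. Qed.
Fact endo_opp_linear (f : endo) : `[< linear (fun v => - f v) >].
Proof. by apply/asboolP => c u v; rewrite endo_linear opprD scalerN. Qed.
Fact endo_add_linear (f g : endo) : `[< linear (fun v => f v + g v) >].
Proof. by apply/asboolP => c u v; rewrite !endo_linear scalerDr addrACA. Qed.
Fact endo_one_linear : `[< linear (fun v : V => v) >].
Proof. exact/asboolP. Qed.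
Fact endo_mul_linear (f g : endo) : `[< linear (fun v => f (g v)) >].
Proof. by apply/asboolP => c u v; rewrite !endo_linear. Qed.
Fact endo_scale_linear (c : K) : `[< linear (fun v : V => c *: v) >].
Proof. by apply/asboolP => d u v; rewrite scalerDr !scalerA mulrC. Qed.

Definition endo_zero := Endo endo_zero_linear.
Definition endo_opp f := Endo (endo_opp_linear f).
Definition endo_add f g := Endo (endo_add_linear f g).
Definition endo_one := Endo endo_one_linear.
Definition endo_mul f g := Endo (endo_mul_linear f g).
Definition endo_scale c := Endo (endo_scale_linear c).

Fact endo_addA : associative endo_add.
Proof. by move=> f g h; apply: endoP => v /=; rewrite addrA. Qed.
Fact endo_addC : commutative endo_add.
Proof. by move=> f g; apply: endoP => v /=; rewrite addrC. Qed.
Fact endo_add0 : left_id endo_zero endo_add.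
Proof. by move=> f; apply: endoP => v /=; rewrite add0r. Qed.
Fact endo_addN : left_inverse endo_zero endo_opp endo_add.
Proof. by move=> f; apply: endoP => v /=; rewrite addNr. Qed.
HB.instance Definition _ :=
  GRing.isZmodule.Build endo endo_addA endo_addC endo_add0 endo_addN.

Fact endo_mulA : associative endo_mul.
Proof. by move=> f g h; apply: endoP. Qed.
Fact endo_mul1 : left_id endo_one endo_mul.
Proof. by move=> f; apply: endoP. Qed.
Fact endo_mulr1 : right_id endo_one endo_mul.
Proof. by move=> f; apply: endoP. Qed.
Fact endo_mulDl : left_distributive endo_mul +%R.
Proof. by move=> f g h; apply: endoP. Qed.
Fact endo_mulDr : right_distributive endo_mul +%R.
Proof. by move=> f g h; apply: endoP => v /=; rewrite endoD. Qed.
HB.instance Definition _ := GRing.Zmodule_isPzRing.Build endo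
  endo_mulA endo_mul1 endo_mulr1 endo_mulDl endo_mulDr.

Fact endo_scale_zmod_morphism : zmod_morphism endo_scale.
Proof. by move=> c d; apply: endoP => v /=; rewrite scalerBl. Qed.
Fact endo_scale_monoid_morphism : monoid_morphism endo_scale.
Proof. by split=> [|c d]; apply: endoP => v /=; rewrite ?scale1r ?scalerA. Qed.
HB.instance Definition _ := GRing.isZmodMorphism.Build K endo
  endo_scale endo_scale_zmod_morphism.
HB.instance Definition _ := GRing.isMonoidMorphism.Build K endo
  endo_scale endo_scale_monoid_morphism.

Lemma endo_scale_comm c f : endo_scale c * f = f * endo_scale c.
Proof. by apply: endoP => v /=; rewrite endoZ. Qed.

End Endomorphisms.

(* On sequences f : (I -> nat) -> K the shift by e_a and the operator
   f |-> m_a f(m - e_a) satisfy the relations of d/dx_a and x_a. *)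
Section WeylOperators.
Variables (K : comNzRingType) (I : eqType).
Implicit Types (f : (I -> nat) -> K^o) (m : I -> nat) (a b : I).

Definition incr a m : I -> nat := fun c => (m c + (c == a))%N.
(** The truncation at 0 is harmless, because the multiplication operator carries the factor m a,
    which vanishes there. *)
Definition decr a m : I -> nat := fun c => (m c - (c == a))%N.

Fact shift_linear a : `[< linear (fun f : (I -> nat) -> K^o => (fun m => f (incr a m)) : (I -> nat) -> K^o) >].
Proof. by apply/asboolP => c f g; apply/funext. Qed.
Fact mulx_linear a : `[< linear (fun f : (I -> nat) -> K^o => (fun m => (m a)%:R * f (decr a m)) : (I -> nat) -> K^o) >].
Proof.
apply/asboolP => c f g; apply/funext => m.
rewrite -[LHS]/((m a)%:R * (c * f (decr a m) + g (decr a m))).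
rewrite -[RHS]/(c * ((m a)%:R * f (decr a m)) + (m a)%:R * g (decr a m)).
by rewrite mulrDr mulrCA.
Qed.

Definition weyl := endo ((I -> nat) -> K^o).
HB.instance Definition _ := GRing.PzRing.on weyl.

Fact weyl_nonzero : (1 : weyl) != 0.
Proof.
apply/eqP => /(congr1 (fun F : weyl => F (fun=> 1) (fun=> 0%N))) /eqP.
by rewrite [_ == _]oner_eq0.
Qed.
HB.instance Definition _ := GRing.PzSemiRing_isNonZero.Build weyl weyl_nonzero.

Definition weyl_scalar : {rmorphism K -> weyl} := @endo_scale K _.

Lemma weyl_scalar_comm c (F : weyl) : weyl_scalar c * F = F * weyl_scalar c.
Proof. exact: endo_scale_comm. Qed.

Definition weyl_d a : weyl := Endo (shift_linear a).
Definition weyl_x a : weyl := Endo (mulx_linear a).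

(** If f m is read as the partial derivative of order m at 0 of a power series, the two operators
    are differentiation and, by the Leibniz rule, multiplication by a variable. *)
Lemma weyl_dx a b : weyl_d a * weyl_x b = weyl_x b * weyl_d a + (a == b)%:R.
Proof.
apply: endoP => f; apply/funext => m.
have natE (k : nat) : (k%:R : weyl) f m = k%:R * f m.
  elim: k => [|k IHk]; first by rewrite mul0r.
  by rewrite mulrS [k.+1%:R in RHS]mulrS mulrDl mul1r -IHk.
rewrite -[RHS]/((m b)%:R * f (incr a (decr b m)) + ((a == b)%:R : weyl) f m) natE.
rewrite -[LHS]/((m b + (b == a))%:R * f (decr b (incr a m))).
rewrite eq_sym natrD mulrDl; have [<-|ab] := eqVneq a b.
  have -> : decr a (incr a m) = m by apply/funext => c; rewrite /decr /incr addnK.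
  (* Only for m a > 0 do the shift down and the shift up cancel; at m a = 0 both sides have
     coefficient 0. *)
  congr (_ + _); case E : (m a) => [|k]; first by rewrite !mul0r.
  congr (_ * f _); apply/funext => c; rewrite /decr /incr.
  by have [->|_] := eqVneq c a; rewrite ?E ?subn0 ?addn0 // subnK.
rewrite !mul0r; congr (_ * f _ + _); apply/funext => c; rewrite /decr /incr.
have [->|_] := eqVneq c a; last by rewrite !addn0.
by rewrite (negPf ab) !subn0.
Qed.

Lemma weyl_dd a b : weyl_d a * weyl_d b = weyl_d b * weyl_d a.
Proof.
apply: endoP => f; apply/funext => m; congr (f _).
by apply/funext => c; rewrite /incr addnAC.
Qed.

Lemma weyl_xx a b : weyl_x a * weyl_x b = weyl_x b * weyl_x a.
Proof.
apply: endoP => f; apply/funext => m.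
rewrite -[LHS]/((m a)%:R * ((m b - (b == a))%:R * f (decr b (decr a m)))).
rewrite -[RHS]/((m b)%:R * ((m a - (a == b))%:R * f (decr a (decr b m)))).
have [->//|ab] := eqVneq a b.
rewrite !subn0 mulrCA; congr (_ * (_ * f _)).
by apply/funext => c; rewrite /decr subnAC.
Qed.

End WeylOperators.

Arguments weyl_scalar {K I}.

(** * Representations of the Yangian built from commuting copies of gl_n *)

(** This is the comultiplication of Y(n) for two commuting families: T'_1 commutes with T_2, so T_1
    T'_1 T_2 T'_2 regroups as T_1 T_2 T'_1 T'_2 and the R-matrix passes each pair in turn. *)
Lemma yangian_mul (A : pzRingType) n (T T' : fps 'M[A]_n) :
  (forall i j a b, yangian_eqn T i j a b = 0) ->
  (forall i j a b, yangian_eqn T' i j a b = 0) ->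
  (forall p q i j a b, T p i j * T' q a b = T' q a b * T p i j) ->
  forall i j a b, yangian_eqn (T * T') i j a b = 0.
Proof.
move=> YT YT' TT'; apply: yangian_of_RTT; rewrite !rmorphM.
have C : B1 T' * B2 T = B2 T * B1 T'.
  apply/fpsP => p; apply/fpsP => q; apply: tens_matrixP => i a j b.
  by rewrite B12E B21E TT'.
have C' : B2 T' * B1 T = B1 T * B2 T'.
  apply/fpsP => p; apply/fpsP => q; apply: tens_matrixP => i a j b.
  by rewrite B12E B21E TT'.
move: (RTT YT) (RTT YT') C C'.
move: (R_sub _ _) (B1 T) (B2 T) (B1 T') (B2 T') => r x y x' y' rxy rxy' C C'.
have -> : x * x' * (y * y') = x * y * (x' * y').
  by rewrite -!mulrA (mulrA x') C -!mulrA.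
have -> : y * y' * (x * x') = y * x * (y' * x').
  by rewrite -!mulrA (mulrA y') C' -!mulrA.
by rewrite (mulrA r) rxy -(mulrA _ r) rxy' !mulrA.
Qed.

(* The image of T(u) under the evaluation homomorphism Y(n) -> U(gl_n). *)
Definition evaluation (A : pzRingType) n (E : 'M[A]_n) : fps 'M[A]_n :=
  1 + fps_const E * fps_X _.

Lemma evaluationE (A : pzRingType) n (E : 'M[A]_n) :
  evaluation E = Fps (fun r => match r with 0 => 1 | 1 => E | _ => 0 end).
Proof.
apply/fpsP => r; rewrite /evaluation fpsDE fps1E fps_constM.
by case: r => [|[|r]] /=; rewrite ?mulr0 ?mulr1 ?addr0 ?add0r.
Qed.

(** The commutator of the series lives in degree (1,1) only, so the relation has content just at
    u^-2 v^-1 and u^-1 v^-2, and there it is the commutation relation of gl_n. *)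
Lemma yangian_evaluation (A : pzRingType) n (E : 'M[A]_n) :
  (forall i j k l, E i j * E k l - E k l * E i j
     = E i l *+ (j == k) - E k j *+ (i == l)) ->
  forall i j a b, yangian_eqn (evaluation E) i j a b = 0.
Proof.
move=> glE i j a b; rewrite evaluationE.
apply/fpsP => p; apply/fpsP => q.
rewrite /yangian_eqn -[u_inv A * _ * _]mulrA mulrBl !(fpsDE, fpsNE).
case: p q => [|[|[|p]]] [|[|[|q]]]; rewrite !(u_invE, v_invE) ?fps0E //;
  rewrite ?(fpsDE, fpsNE, ser_uvE, ser_vuE) /=.
all: rewrite ?mxE ?mulr0 ?mul0r ?subr0 ?oppr0 ?addr0 //.
all: have sC k (y : A) : k%:R * y - y * k%:R = 0 by rewrite (commr_nat y k) subrr.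
all: have sC' k (y : A) : y * k%:R - k%:R * y = 0 by rewrite (commr_nat y k) subrr.
all: by rewrite ?(sC, sC', subrr, subr0) // ?glE ?mulr_natl ?mulr_natr ?(eq_sym j a)
  ?sub0r ?subrr ?oppr0 ?opprB ?addrA ?subrK ?subrr.
Qed.

Section GlRelations.
Variables (R : nzRingType) (n : nat) (z : R).
Local Notation I := (nat * 'I_n * 'I_n)%type.
Variables (x d : I -> R).
Hypothesis xx : forall a b, x a * x b = x b * x a.
Hypothesis dd : forall a b, d a * d b = d b * d a.
Hypothesis dx : forall a b, d a * x b = x b * d a + (a == b)%:R.
Hypothesis zC : forall y, z * y = y * z.

Definition vector_field p i j : R := \sum_a x (p, i, a) * d (p, j, a).

(** The index p labels independent copies of the variables, hence commuting copies of gl_n. *)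
Definition gl_operator p : 'M[R]_n :=
  \matrix_(i, j) (vector_field p i j + z * x (p, i, j)).

Lemma vector_field_x p q i j k m :
  vector_field p i j * x (q, k, m)
    = x (q, k, m) * vector_field p i j + x (p, i, m) *+ ((p == q) && (j == k)).
Proof.
rewrite /vector_field mulr_suml mulr_sumr.
rewrite -(sum_pick (fun a => x (p, i, a) *+ ((p == q) && (j == k))) m) -big_split.
apply: eq_bigr => a _ /=; rewrite -mulrA dx mulrDr !mulrA xx mulr_natr; congr (_ + _).
by rewrite !xpair_eqE -mulrnA mulnb (eq_sym m).
Qed.

Lemma vector_field_d p q i j k m :
  d (q, k, m) * vector_field p i j
    = vector_field p i j * d (q, k, m) + d (p, j, m) *+ ((p == q) && (i == k)).
Proof.
rewrite /vector_field mulr_suml mulr_sumr.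
rewrite -(sum_pick (fun a => d (p, j, a) *+ ((p == q) && (i == k))) m) -big_split.
apply: eq_bigr => a _ /=; rewrite mulrA dx mulrDl -!mulrA dd mulr_natl; congr (_ + _).
by rewrite !xpair_eqE -mulrnA mulnb (eq_sym q) (eq_sym k).
Qed.

Lemma vector_field_comm p q i j k l :
  vector_field p i j * vector_field q k l - vector_field q k l * vector_field p i j
    = (vector_field p i l *+ (j == k) - vector_field p k j *+ (i == l)) *+ (p == q).
Proof.
rewrite {2 3}/vector_field mulr_sumr mulr_suml -sumrB.
transitivity (\sum_b (x (p, i, b) * d (q, l, b) *+ ((p == q) && (j == k))
    - x (q, k, b) * d (p, j, b) *+ ((p == q) && (i == l)))).
  apply: eq_bigr => b _; rewrite mulrA vector_field_x mulrDl -!mulrA vector_field_d.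
  by rewrite mulrDr opprD addrACA subrr add0r mulrnAl mulrnAr.
have [<-|_] := eqVneq p q; last by rewrite big1 // => b _; rewrite !mulr0n subr0.
by rewrite sumrB /vector_field !sumrMnl.
Qed.

(** The vector fields act on x_kl through its first index exactly as they act on each other in the
    term delta_jk, so the two mixed brackets supply the z x terms of the result, and the products of
    two z x terms cancel because the variables commute. *)
Lemma gl_operator_comm p q i j k l :
  gl_operator p i j * gl_operator q k l - gl_operator q k l * gl_operator p i j
    = (gl_operator p i l *+ (j == k) - gl_operator p k j *+ (i == l)) *+ (p == q).
Proof.
rewrite !mxE; set F := vector_field; pose X p i j := x (p, i, j).
have cross : F p i j * (z * X q k l) - (z * X q k l) * F p i j
    = z * X p i l *+ ((p == q) && (j == k)).
  by rewrite mulrA -zC -!mulrA -mulrBr /F vector_field_x addrC addKr mulrnAr.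
have cross' : F q k l * (z * X p i j) - (z * X p i j) * F q k l
    = z * X q k j *+ ((p == q) && (i == l)).
  rewrite mulrA -zC -!mulrA -mulrBr /F vector_field_x addrC addKr mulrnAr.
  by rewrite (eq_sym q) (eq_sym l).
have zz : z * X p i j * (z * X q k l) = z * X q k l * (z * X p i j).
  by rewrite -!mulrA !(mulrA (X _ _ _)) -!zC -!mulrA /X xx.
rewrite -/(X p i j) -/(X q k l) mulrDl mulrDl !mulrDr zz.
have -> (V : zmodType) (a b c e a' b' c' : V) :
    a + b + (c + e) - (a' + b' + (c' + e)) = a - a' + (b - c') - (b' - c).
  rewrite !opprD !opprK !addrA [LHS](ACl (1*5*2*7*6*3*(4*8)))%AC.
  by rewrite /= subrr addr0.
rewrite vector_field_comm cross cross'; have [<-|_] := eqVneq p q; last first.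
  by rewrite !mulr0n !addr0 subr0.
by rewrite /= !mulr1n !mulrnDl opprD [RHS]addrACA !addrA.
Qed.

End GlRelations.

Section WeylYangian.
Variables (K : comNzRingType) (n : nat) (A : nat -> 'M[K]_n).
Local Notation I := (nat * 'I_n * 'I_n)%type.
Local Notation W := (weyl K I).

(** The variable 'X is z. Since the shift is central, the Weyl relations with the unshifted
    derivations persist, and the top coefficient in 'X becomes a scalar. *)
Definition shifted_x (a : I) : {poly W} :=
  (weyl_x K a)%:P + (weyl_scalar (A a.1.1 a.1.2 a.2))%:P * 'X.
Definition poly_d (a : I) : {poly W} := (weyl_d K a)%:P.

Lemma scaleC_comm (c : K) (P : {poly W}) : (weyl_scalar c)%:P * P = P * (weyl_scalar c)%:P.
Proof. by apply/polyP => k; rewrite coefCM coefMC; apply: weyl_scalar_comm. Qed.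

Lemma shifted_xx a b : shifted_x a * shifted_x b = shifted_x b * shifted_x a.
Proof.
have XC (P : {poly W}) : 'X * P = P * 'X by rewrite -commr_polyX.
have cC c (P : {poly W}) : (weyl_scalar c)%:P * 'X * P = P * ((weyl_scalar c)%:P * 'X).
  by rewrite -mulrA XC mulrA scaleC_comm mulrA.
have gen (R : pzRingType) (x y u v : R) : x * y = y * x ->
    (forall P, u * P = P * u) -> (forall P, v * P = P * v) ->
    (x + u) * (y + v) = (y + v) * (x + u).
  move=> xy uC vC; rewrite !mulrDl !mulrDr xy (uC y) (uC v) (vC x).
  exact: addrACA.
apply: gen; [|exact: cC|exact: cC].
have := congr1 (fun F : W => F%:P) (weyl_xx K a b); by rewrite !polyCM.
Qed.

Lemma poly_dd a b : poly_d a * poly_d b = poly_d b * poly_d a.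
Proof. by rewrite /poly_d -!polyCM weyl_dd. Qed.

Lemma poly_dx a b : poly_d a * shifted_x b = shifted_x b * poly_d a + (a == b)%:R.
Proof.
have XC (P : {poly W}) : 'X * P = P * 'X by rewrite -commr_polyX.
rewrite /shifted_x mulrDr mulrDl /poly_d -!polyCM weyl_dx polyCD polyC_natr.
by rewrite mulrA -scaleC_comm -!mulrA XC addrAC.
Qed.

Definition weyl_E p : 'M[{poly W}]_n := gl_operator 'X shifted_x poly_d p.

Fixpoint weyl_T N : fps 'M[{poly W}]_n :=
  if N is N'.+1 then weyl_T N' * evaluation (weyl_E N') else 1.

Lemma weyl_E_comm p q i j k l : p != q ->
  weyl_E p i j * weyl_E q k l = weyl_E q k l * weyl_E p i j.
Proof.
move=> pq; apply/eqP; rewrite -subr_eq0.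
rewrite (gl_operator_comm shifted_xx poly_dd poly_dx); first by rewrite (negPf pq).
by move=> P; rewrite -commr_polyX.
Qed.

Lemma commute_mul (R : pzRingType) (x y z : R) :
  x * z = z * x -> y * z = z * y -> x * y * z = z * (x * y).
Proof. by move=> xz yz; rewrite -mulrA yz !mulrA xz. Qed.

Lemma weyl_T_comm_E N p r i j k l : (N <= p)%N ->
  weyl_T N r i j * weyl_E p k l = weyl_E p k l * weyl_T N r i j.
Proof.
(* Constant coefficients are matrices with entries 0 or 1, which are central; the disjunction covers
   the degree 0 coefficient and the zero coefficients with one statement. *)
have scalarC (M : 'M[{poly W}]_n) s : s = 0%N \/ M = 0 -> forall o o',
    (if s is 0 then 1 else M) o o' * weyl_E p k l
      = weyl_E p k l * (if s is 0 then 1 else M) o o'.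
  case=> -> o o'; first by rewrite mxE (commr_nat (weyl_E p k l)).
  by case: s => [|s]; rewrite mxE ?mul0r ?mulr0 // (commr_nat (weyl_E p k l)).
elim: N r i j => [|N IHN] r i j Np.
  by apply: (scalarC 0 r); right.
rewrite -[weyl_T N.+1]/(weyl_T N * evaluation (weyl_E N)) fpsME summxE.
rewrite mulr_suml mulr_sumr; apply: eq_bigr => m _.
rewrite mxE mulr_suml mulr_sumr; apply: eq_bigr => o _.
apply: commute_mul; first exact/IHN/ltnW.
rewrite evaluationE; case: (r - m)%N => [|[|s]] /=.
- by apply: (scalarC 0 0%N); left.
- by apply: weyl_E_comm; rewrite neq_ltn Np.
- by apply: (scalarC 0 1%N); right.
Qed.

Lemma weyl_T_yangian N i j a b : yangian_eqn (weyl_T N) i j a b = 0.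
Proof.
elim: N i j a b => [|N IHN] /= i j a b.
  have -> : 1 = evaluation (0 : 'M[{poly W}]_n) by rewrite /evaluation rmorph0 mul0r addr0.
  by apply: yangian_evaluation => *; rewrite !mxE !mul0r subrr !mul0rn subrr.
move: i j a b.
apply: yangian_mul; first exact: IHN.
  apply: yangian_evaluation => i j k l.
  rewrite (gl_operator_comm shifted_xx poly_dd poly_dx); first by rewrite eqxx mulr1n.
  by move=> P; rewrite -commr_polyX.
move=> p q i j a b; rewrite evaluationE; case: q => [|[|q]] /=.
- by rewrite mxE commr_nat.
- exact: weyl_T_comm_E.
- by rewrite mxE mulr0 mul0r.
Qed.

Lemma weyl_T0 N : weyl_T N 0 = 1.
Proof.
elim: N => [//|N IHN].
rewrite -[weyl_T N.+1]/(weyl_T N * evaluation (weyl_E N)).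
by rewrite fpsME big_ord1 IHN mul1r evaluationE.
Qed.

End WeylYangian.

(** * Scalar top coefficients in z *)

Section Symbols.
Variables (K : comNzRingType) (W : nzRingType) (sigma : {rmorphism K -> W}).
Implicit Types (P Q : {poly W}).

(** The degree a is prescribed instead of being read off P, and s may be 0. This makes symbols
    additive in a fixed degree, with no case of cancelling leading terms. *)
Definition symbol (a : nat) (s : K) P := (size P <= a.+1)%N /\ P`_a = sigma s.

Lemma symbol0 a : symbol a 0 0.
Proof. by rewrite /symbol size_poly0 coef0 rmorph0. Qed.

Lemma symbolD a s t P Q : symbol a s P -> symbol a t Q -> symbol a (s + t) (P + Q).
Proof.
move=> [sP Ps] [sQ Qt]; split; last by rewrite coefD Ps Qt rmorphD.
by apply: leq_trans (size_polyD _ _) _; rewrite geq_max sP.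
Qed.

Lemma symbolN a s P : symbol a s P -> symbol a (- s) (- P).
Proof. by move=> [sP Ps]; rewrite /symbol size_polyN coefN Ps rmorphN. Qed.

Lemma symbolM a b s t P Q : symbol a s P -> symbol b t Q -> symbol (a + b) (s * t) (P * Q).
Proof.
move=> [sP Ps] [sQ Qt]; split.
  by apply: leq_trans (size_polyMleq _ _) _; lia.
have lt_a : (a < (a + b).+1)%N by lia.
rewrite coefM (bigD1 (Ordinal lt_a)) //= addKn Ps Qt rmorphM big1 ?addr0 // => i.
rewrite -val_eqE /= neq_ltn => /orP[ia|ai].
  by rewrite [Q`_ _]nth_default ?mulr0 //; apply: leq_trans sQ _; lia.
by rewrite [P`_ _]nth_default ?mul0r //; apply: leq_trans sP _; lia.
Qed.

Lemma symbol_sum a (I : Type) (r : seq I) (s : I -> K) (P : I -> {poly W}) :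
  (forall i, symbol a (s i) (P i)) -> symbol a (\sum_(i <- r) s i) (\sum_(i <- r) P i).
Proof.
move=> sP; elim: r => [|i r IHr]; rewrite ?big_nil ?big_cons; first exact: symbol0.
exact: symbolD.
Qed.

Lemma symbolC s : symbol 0 s (sigma s)%:P.
Proof. by rewrite /symbol size_polyC leq_b1 coefC. Qed.

Lemma symbol_lower a P : (size P <= a)%N -> symbol a 0 P.
Proof. by move=> sP; split; [apply: leqW | rewrite nth_default ?rmorph0]. Qed.

Section Series.
Variable n : nat.
Implicit Types (F H : fps 'M[{poly W}]_n) (f h : fps 'M[K]_n).

(* Doubling the degree accounts for gl_operator being quadratic in 'X. *)
Definition has_symbol f F := forall r i j, symbol (2 * r) (f r i j) (F r i j).

Lemma has_symbolM f h F H : has_symbol f F -> has_symbol h H -> has_symbol (f * h) (F * H).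
Proof.
move=> fF hH r i j; rewrite !fpsME !summxE; apply: symbol_sum => k.
rewrite !mxE; apply: symbol_sum => o.
have -> : (2 * r = 2 * k + 2 * (r - k))%N by have := ltn_ord k; lia.
exact: symbolM.
Qed.

Lemma has_symbolB f h F H : has_symbol f F -> has_symbol h H -> has_symbol (f - h) (F - H).
Proof.
move=> fF hH r i j; have subE (R : pzRingType) (u v : fps 'M[R]_n) :
    (u - v) r i j = u r i j - v r i j by rewrite -[fps_coef _ r]/(u r - v r) !mxE.
by rewrite !subE; apply/symbolD/symbolN.
Qed.

Lemma has_symbol_const (M : 'M[K]_n) (M' : 'M[{poly W}]_n) :
  (forall i j, symbol 0 (M i j) (M' i j)) -> has_symbol (fps_const M) (fps_const M').
Proof. by move=> MM [|r] i j //=; rewrite !mxE; apply: symbol0. Qed.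

Lemma has_symbol_neg f F : has_symbol f F -> has_symbol (fps_neg f) (fps_neg F).
Proof.
by move=> fF r i j /=; case: odd => //; rewrite !mxE; apply: symbolN.
Qed.

Lemma has_symbol1 : has_symbol 1 1.
Proof.
apply: has_symbol_const => i j; rewrite !mxE.
case: eqP => _; rewrite ?mulr1n ?mulr0n; last exact: symbol0.
by have := symbolC 1; rewrite rmorph1 polyC1.
Qed.

Lemma has_symbol_sign l : has_symbol (fps_const (sign_mx K n l))
  (fps_const (sign_mx {poly W} n l)).
Proof.
apply: has_symbol_const => i j; rewrite !mxE.
have s1 : symbol 0 1 1 by have := symbolC 1; rewrite rmorph1 polyC1.
case: eqP => _; rewrite ?mulr1n ?mulr0n; last exact: symbol0.
by case: ifP => _ //; apply: symbolN.
Qed.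

Lemma has_symbolX f F k : has_symbol f F -> has_symbol (f ^+ k) (F ^+ k).
Proof.
move=> fF; elim: k => [|k IHk]; first by rewrite !expr0; apply: has_symbol1.
by rewrite !exprS; apply: has_symbolM.
Qed.

Lemma has_symbol_inv f F : has_symbol f F -> has_symbol (fps_inv f) (fps_inv F).
Proof.
move=> fF r i j; rewrite /= !summxE; apply: symbol_sum => k.
by apply: has_symbolX; apply: has_symbolB => //; apply: has_symbol1.
Qed.

Lemma has_symbol_evaluation (M : 'M[K]_n) (E : 'M[{poly W}]_n) :
  (forall i j, symbol 2 (M i j) (E i j)) -> has_symbol (evaluation M) (evaluation E).
Proof.
move=> ME; rewrite !evaluationE => -[|[|r]] i j /=; last first.
- by rewrite !mxE; apply: symbol0.
- exact: ME.
exact: (has_symbol1 0).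
Qed.

Lemma has_symbol_twisted l f F : has_symbol f F -> has_symbol (twisted l f) (twisted l F).
Proof.
move=> fF; apply: has_symbolM; last exact/has_symbol_neg/has_symbol_inv.
by apply: has_symbolM => //; apply: has_symbol_sign.
Qed.

End Series.
End Symbols.

(** The scalar counterpart of [weyl_T]; its value is an arbitrary product of evaluations at constant
    matrices, with no gl_n relation imposed. *)
Fixpoint classical_T (R : pzRingType) n (M : nat -> 'M[R]_n) N : fps 'M[R]_n :=
  if N is N'.+1 then classical_T M N' * evaluation (M N') else 1.

Lemma weyl_T_symbol (K : comNzRingType) n (M : nat -> 'M[K]_n) N :
  has_symbol (@weyl_scalar K _) (classical_T M N) (weyl_T M N).
Proof.
elim: N => [|N IHN]; first exact: has_symbol1.
apply: has_symbolM IHN _; apply: has_symbol_evaluation => i j; rewrite mxE.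
have sx a : symbol weyl_scalar 1 (M a.1.1 a.1.2 a.2) (shifted_x M a).
  rewrite /shifted_x -[X in symbol _ _ X _]add0r; apply: symbolD.
    by apply: symbol_lower; rewrite size_polyC leq_b1.
  split; last by rewrite coefMX coefC /=.
  by apply: leq_trans (size_polyMleq _ _) _; rewrite size_polyX size_polyC; case: eqP.
rewrite -[X in symbol _ _ X _]add0r; apply: symbolD.
  (* The vector field has degree at most 1 in 'X. Counting its derivation in degree 1 with symbol 0
     shows that it contributes nothing in degree 2. *)
  have -> : 0 = \sum_(a < n) (0 : K) by rewrite big1.
  apply: symbol_sum => a; rewrite -[X in symbol _ _ X _](mulr0 (M N i a)).
  apply: (symbolM (a := 1) (b := 1)); first exact: (sx (N, i, a)).
  by apply: symbol_lower; rewrite size_polyC leq_b1.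
(* The remaining summand, 'X times the shifted variable, contributes the entry of M. *)
rewrite -[X in symbol _ _ X _]mul1r; apply: (symbolM (a := 1) (b := 1)); last exact: (sx (N, i, j)).
by split; rewrite ?size_polyX // coefX rmorph1.
Qed.

Lemma weyl_scalar_inj (K : comNzRingType) (I : eqType) : injective (@weyl_scalar K I).
Proof.
move=> c c' /(congr1 (fun F : weyl K I => F (fun=> 1) (fun=> 0%N))).
by rewrite -[LHS]/(c * 1) -[RHS]/(c' * 1) !mulr1.
Qed.

Lemma symbol_word (K : comNzRingType) (W : nzRingType) (sigma : {rmorphism K -> W}) n
    (f : fps 'M[K]_n) (F : fps 'M[{poly W}]_n) (w : seq (letter n)) :
  has_symbol sigma f F ->
  symbol sigma (2 * weight (@order n) w) (\prod_(g <- w) gen_value f g)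
    (\prod_(g <- w) gen_value F g).
Proof.
move=> fF; elim: w => [|g w IHw].
  by rewrite !big_nil weight_nil; have := symbolC sigma 1; rewrite rmorph1 polyC1.
by rewrite !big_cons weight_cons mulnDr; apply: symbolM IHw; apply: fF.
Qed.

Lemma map_twisted (R S : pzRingType) (f : {rmorphism R -> S}) n l (T : fps 'M[R]_n) :
  fps_map (map_mx f) (twisted l T) = twisted l (fps_map (map_mx f) T).
Proof.
rewrite /twisted !rmorphM /= -(fps_neg_map (map_mx f)) (fps_inv_map (map_mx f)).
by rewrite (fps_map_const (map_mx f)) /= (map_sign_mx f).
Qed.

(** Applying the Weyl representation to the image under phi gives the zero polynomial in 'X. In
    degree 2d, words of weight below d are invisible by the degree bound, and each word of weight d
    leaves its value at the scalar point; injectivity of the scalars then gives an identity in K. *)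
Lemma top_part_vanishes (K : comNzRingType) n l
    (phi : {lrmorphism reflection_algebra K n l -> yangian K n})
    (s : seq (K * seq (letter n))) d (M : nat -> 'M[K]_n) N :
  fps_map (map_mx phi) (reflection_B K n l) = twisted l (yangian_T K n) ->
  all (fun cw => weight (@order n) cw.2 <= d)%N s ->
  phi (word_comb (gen_value (reflection_B K n l)) s) = 0 ->
  \sum_(cw <- s | weight (@order n) cw.2 == d)
     cw.1 * \prod_(g <- cw.2) gen_value (twisted l (classical_T M N)) g = 0.
Proof.
move=> phiB sd phi0; pose W := weyl K (letter n).
pose iota : {rmorphism K -> {poly W}} := polyC \o weyl_scalar.
have [rho rhoT rhoZ] := yangian_lift (iota := iota) (@scaleC_comm K n)
  (weyl_T0 M N) (weyl_T_yangian M N).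
pose Y := twisted l (weyl_T M N).
have rhoB g : rho (phi (gen_value (reflection_B K n l) g)) = gen_value Y g.
  rewrite /Y -rhoT -map_twisted -phiB /gen_value.
  by rewrite [RHS]mxE; congr (rho _); rewrite [RHS]mxE.
have rhophi : 0 = \sum_(cw <- s) iota cw.1 * \prod_(g <- cw.2) gen_value Y g.
  transitivity (rho (phi (word_comb (gen_value (reflection_B K n l)) s))).
    by rewrite phi0 rmorph0.
  rewrite /word_comb linear_sum rmorph_sum; apply: eq_bigr => cw _.
  rewrite linearZ rhoZ rmorph_prod rmorph_prod; congr (_ * _).
  by apply: eq_bigr => g _; rewrite rhoB.
apply: (@weyl_scalar_inj _ (letter n)); rewrite rmorph0.
have := congr1 (fun P : {poly W} => P`_(2 * d)) rhophi; rewrite coef0 => ->.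
have symw := symbol_word _ (has_symbol_twisted l (weyl_T_symbol M N)).
rewrite coef_sum rmorph_sum big_mkcond /=.
elim: s sd {phi0 rhophi} => [|[c w] s IHs] /=; first by rewrite !big_nil.
case/andP=> wd sd; rewrite !big_cons IHs //; congr (_ + _).
have [ws swd] := symw w; rewrite /= coefCM; move: wd; rewrite leq_eqVlt.
case: eqP => [<- _|_ /= wd]; first by rewrite swd rmorphM.
rewrite [X in _ * X]nth_default ?mulr0 //.
by apply: leq_trans ws _; lia.
Qed.

(** * Products of evaluations with prescribed coefficients *)

(* Multiplication by 1 + c e u^-d with e idempotent factors into evaluations
   because 1 + c X^d splits into linear factors over an algebraically closed field. *)
Section Realization.
Variables (K : numClosedFieldType) (n : nat).
Implicit Types (f h : fps 'M[K]_n) (e D : 'M[K]_n) (p q : {poly K}).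

Definition realizable f := exists (M : nat -> 'M[K]_n) N, f = classical_T M N.

Lemma realizable1 : realizable 1.
Proof. by exists (fun=> 0), 0%N. Qed.

Lemma realizable_evaluation f e : realizable f -> realizable (f * evaluation e).
Proof.
case=> M [N ->]; pose M' m := if m == N then e else M m; exists M', N.+1.
have TE k : (k <= N)%N -> classical_T M k = classical_T M' k.
  elim: k => [//|k IHk] kN; rewrite /= IHk; last exact: ltnW.
  by rewrite /M' (ltn_eqF kN).
by rewrite (TE N) //= /M' eqxx.
Qed.

Let mulZr (a : K) (M M' : 'M[K]_n) : M * (a *: M') = a *: (M * M').
Proof. exact: esym (scalemxAr _ _ _). Qed.
Let mulZl (a : K) (M M' : 'M[K]_n) : (a *: M) * M' = a *: (M * M').
Proof. exact: esym (scalemxAl _ _ _). Qed.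

(** For idempotent e this acts as p(u^-1) on the image of e and as the identity on the kernel, so it
    is multiplicative in p, and a linear factor of p becomes an evaluation. *)
Definition idempotent_series e p : fps 'M[K]_n :=
  fps_const (1 - e) + Fps (fun r => p`_r *: e).

Lemma idempotent_seriesM e p q : e * e = e ->
  idempotent_series e (p * q) = idempotent_series e p * idempotent_series e q.
Proof.
move=> ee; have ze : (1 - e) * e = 0 by rewrite mulrBl mul1r ee subrr.
have ez : e * (1 - e) = 0 by rewrite mulrBr mulr1 ee subrr.
have zz : (1 - e) * (1 - e) = 1 - e by rewrite mulrBr mulr1 ze subr0.
rewrite /idempotent_series mulrDl !mulrDr -rmorphM zz -addrA; congr (_ + _).
apply/fpsP => r; rewrite !fpsDE fps_constM fps_Mconst mulZr ze mulZl ez.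
rewrite !scaler0 !add0r fpsME -[LHS]/((p * q)`_r *: e) coefM scaler_suml; apply: eq_bigr => k _ /=.
by rewrite mulZr mulZl ee scalerA mulrC.
Qed.

Lemma idempotent_series1 e : idempotent_series e 1 = 1.
Proof.
apply/fpsP => r; rewrite fpsDE fps1E /= coef1.
by case: r => [|r] /=; rewrite ?scale1r ?subrK ?scale0r ?addr0.
Qed.

Lemma idempotent_series_linear e c : idempotent_series e (1 + c *: 'X) = evaluation (c *: e).
Proof.
rewrite evaluationE; apply/fpsP => r; rewrite fpsDE /= coefD coefZ coef1 coefX.
by case: r => [|[|r]] /=;
  rewrite ?mulr0 ?addr0 ?scale1r ?subrK ?mulr1 ?add0r ?scale0r.
Qed.

Lemma split_linear_factors p : p.[0] = 1 ->
  exists s : seq K, p = \prod_(c <- s) (1 + c *: 'X).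
Proof.
move=> p0; have [s ps] := closed_field_poly_normal p.
(* A root z is nonzero because p takes the value 1 at 0, and X - z = (-z)(1 - z^-1 X). The constants
   so extracted multiply with the leading coefficient to p(0) = 1. *)
exists [seq - z^-1 | z <- s].
have s0 z : z \in s -> z != 0.
  move=> zs; apply/eqP => z0; move: p0; rewrite ps hornerZ horner_prod.
  have -> : \prod_(y <- s) ('X - y%:P).[0] = 0.
    by rewrite (big_rem z) //= z0 subr0 hornerX mul0r.
  rewrite mulr0 => /eqP.
  by rewrite eq_sym oner_eq0.
have prodE : \prod_(z <- s) ('X - z%:P)
    = (\prod_(z <- s) (- z)) *: \prod_(c <- [seq - z^-1 | z <- s]) (1 + c *: 'X).
  rewrite big_map -scaler_prod big_seq [RHS]big_seq; apply: eq_bigr => z /s0 z0.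
  rewrite scalerDr scalerA mulrNN divff // scale1r addrC scaleNr.
  by rewrite -mul_polyC mulr1.
rewrite {1}ps prodE scalerA; set a := _ * _.
suff -> : a = 1 by rewrite scale1r.
move: p0; rewrite ps prodE scalerA -/a hornerZ horner_prod big_map big1 ?mulr1 // => z _.
by rewrite !hornerE.
Qed.

Lemma realizable_idempotent f e c d : realizable f -> e * e = e -> (0 < d)%N ->
  realizable (f * idempotent_series e (1 + c *: 'X^d)).
Proof.
move=> rf ee d0; have [|s ->] := split_linear_factors (p := 1 + c *: 'X^d).
  by rewrite !hornerE expr0n (gtn_eqF d0) mulr0 addr0.
elim: s f rf => [|b s IHs] f rf.
  by rewrite big_nil idempotent_series1 mulr1.
rewrite big_cons idempotent_seriesM // mulrA idempotent_series_linear.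
exact/IHs/realizable_evaluation.
Qed.

Lemma realizable_head f : realizable f -> f 0 = 1.
Proof.
case=> M [N ->]; elim: N => [//|N IHN].
rewrite -[classical_T M N.+1]/(classical_T M N * evaluation (M N)).
by rewrite fpsME big_ord1 IHN mul1r evaluationE.
Qed.

(** Quantifying over every realizable starting series makes these D closed under addition, since one
    modification can start from the result of another. *)
Definition reachable d D := forall f, realizable f -> exists h,
  [/\ realizable h, forall k, (k < d)%N -> h k = f k & h d = f d + D].

Lemma reachable0 d : reachable d 0.
Proof. by move=> f rf; exists f; split; rewrite ?addr0. Qed.

Lemma reachableD d D D' : reachable d D -> reachable d D' -> reachable d (D + D').
Proof.
move=> rD rD' f /rD [h [rh hf hd]]; have [h' [rh' hf' hd']] := rD' h rh.
exists h'; split=> // [k kd|]; first by rewrite hf' ?hf.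
by rewrite hd' hd addrA.
Qed.

Lemma reachable_sum d (I : Type) (r : seq I) (F : I -> 'M[K]_n) :
  (forall i, reachable d (F i)) -> reachable d (\sum_(i <- r) F i).
Proof. by move=> rF; apply: big_ind => //; [apply: reachable0 | apply: reachableD]. Qed.

Lemma reachable_idempotent d e c : (0 < d)%N -> e * e = e -> reachable d (c *: e).
Proof.
move=> d0 ee f rf; exists (f * idempotent_series e (1 + c *: 'X^d)).
have sE k : idempotent_series e (1 + c *: 'X^d) k
    = if k == 0%N then 1 else if k == d then c *: e else 0.
  rewrite fpsDE /= coefD coefZ coef1 coefXn; case: k => [|k] /=.
    by rewrite eq_sym (gtn_eqF d0) mulr0 addr0 scale1r subrK.
  by rewrite !add0r; case: eqP => _; rewrite ?mulr1 // mulr0 scale0r.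
have rS := realizable_idempotent c rf ee d0.
move: (idempotent_series _ _) sE rS => S sE rS; split=> // [k kd|].
  rewrite fpsME big_ord_recr /= subnn sE mulr1 big1 ?add0r // => i _.
  by rewrite sE; case: eqP => [|_]; [|case: eqP]; rewrite ?mulr0 //; have := ltn_ord i; lia.
case: d d0 sE => [//|d] _ sE.
rewrite fpsME big_ord_recr big_ord_recl /= subnn !sE mulr1 subn0 /= eqxx.
rewrite (realizable_head rf) mul1r big1 ?addr0 1?addrC // => i _.
rewrite sE /bump; case: eqP => [|_]; [|case: eqP]; rewrite ?mulr0 //; have := ltn_ord i; lia.
Qed.

Lemma reachable_all d D : (0 < d)%N -> reachable d D.
Proof.
move=> d0; rewrite (matrix_sum_delta D).
apply: reachable_sum => i; apply: reachable_sum => j.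
have delta2 (a b c e : 'I_n) : delta_mx a b * delta_mx c e
    = (if b == c then delta_mx a e else 0) :> 'M[K]_n.
  by rewrite -[_ * _]/(_ *m _) mul_delta_mx_cond; case: (b == c).
have [->|ij] := eqVneq i j.
  by apply: reachable_idempotent; rewrite // delta2 eqxx.
(* An off-diagonal matrix unit is nilpotent but is the difference of the idempotents E_ii + E_ij and
   E_ii. *)
pose e := delta_mx i i + delta_mx i j : 'M[K]_n.
have -> : D i j *: delta_mx i j = D i j *: e + (- D i j) *: delta_mx i i :> 'M[K]_n.
  by rewrite scalerDr scaleNr addrAC subrr add0r.
apply: reachableD; apply: reachable_idempotent; rewrite ?delta2 ?eqxx //.
by rewrite mulrDl !mulrDr !delta2 !eqxx eq_sym (negPf ij) !addr0.
Qed.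

End Realization.

(** * Scalar points with arbitrary values at the remaining generators *)

Section RealizeLetters.
Variables (K : numClosedFieldType) (n l : nat).
Implicit Types (f h : fps 'M[K]_n) (D : 'M[K]_n).
Local Notation G := (sign_mx K n l).

(** This is t(u) f(-u) = f(u) G in degree d, solved for t^(d) using f^(0) = 1. It describes the
    twisted series without the inverse of f. *)
Definition twisted_recursion f t := forall d,
  t d = f d * G - \sum_(k < d) t k * ((-1) ^+ (d - k) * f (d - k)%N).

Lemma twisted_rec f : f 0 = 1 -> twisted_recursion f (twisted l f).
Proof.
move=> f0 d; have [_ If] := fps_inv_comm f0.
have tf : twisted l f * fps_neg f = f * fps_const G.
  by rewrite /twisted -mulrA -rmorphM If rmorph1 mulr1.
have {}tf : (twisted l f * fps_neg f) d = f d * G by rewrite tf fps_Mconst.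
rewrite -tf fpsME big_ord_recr subnn.
have -> : fps_neg f 0 = 1 by rewrite -[LHS]/(f 0%N).
rewrite mulr1; under [X in _ = _ - X]eq_bigr do rewrite -fps_negE.
by rewrite addrC addKr.
Qed.

Section Perturbation.
Variables (f h t s : fps 'M[K]_n) (d : nat).
Hypotheses (t_rec : twisted_recursion f t) (s_rec : twisted_recursion h s).
Hypothesis hf : forall k, (k < d)%N -> h k = f k.

Lemma twisted_agree k : (k < d)%N -> s k = t k.
Proof.
elim/ltn_ind: k => k IHk kd; rewrite (s_rec k) (t_rec k) (hf kd); congr (_ - _).
apply: eq_bigr => i _; rewrite (IHk i (ltn_ord i) (ltn_trans (ltn_ord i) kd)).
by rewrite hf // (leq_ltn_trans (leq_subr _ _)).
Qed.

(** The change D enters twice: through f^(d) G, and through the summand k = 0, where t^(0) = G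
    multiplies the changed coefficient of f(-u). *)
Lemma twisted_perturb D : f 0 = 1 -> (0 < d)%N -> h d = f d + D ->
  s d = t d + (D * G - G * ((-1) ^+ d * D)).
Proof.
move=> f0 d0 hd; have t0 : t 0 = G by rewrite (t_rec 0) f0 mul1r big_ord0 subr0.
rewrite (s_rec d) (t_rec d) hd mulrDl.
have -> : \sum_(k < d) s k * ((-1) ^+ (d - k) * h (d - k)%N)
    = \sum_(k < d) t k * ((-1) ^+ (d - k) * f (d - k)%N) + G * ((-1) ^+ d * D).
  rewrite (bigD1 (Ordinal d0)) //= [in RHS](bigD1 (Ordinal d0)) //=.
  rewrite (twisted_agree d0) t0 subn0 hd !mulrDr.
  rewrite -!addrA; congr (_ + _); rewrite addrC; congr (_ + _).
  apply: eq_bigr => i; rewrite -val_eqE /= => i0; rewrite (twisted_agree (ltn_ord i)).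
  by rewrite hf //; have := ltn_ord i; lia.
by rewrite opprD !addrA; congr (_ - _); rewrite addrAC.
Qed.

End Perturbation.

Lemma realize_letters d (y : letter n -> K) : exists f, realizable f /\
  forall g, good_letter l g -> (order g <= d)%N -> gen_value (twisted l f) g = y g.
Proof.
elim: d => [|d [f [rf fy]]]; first by exists 1; split; [apply: realizable1|].
pose eps (i : 'I_n) : K := (-1) ^+ (n - l <= i)%N.
(* In degree d+1 the perturbation adds (eps_j - (-1)^(d+1) eps_i) D_ij, which for a remaining
   generator is 2 eps_j D_ij; D is the missing difference divided by this factor. *)
pose D : 'M[K]_n := \matrix_(i, j)
  ((y (d, i, j) - twisted l f d.+1 i j) / (2%:R * eps j)).
have [h [rh hf hd]] := reachable_all D (ltn0Sn d) rf.
have [f0 h0] := (realizable_head rf, realizable_head rh).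
exists h; split=> // -[[r i] j] good; rewrite /order /= leq_eqVlt => /orP[/eqP[rd]|rd].
  have {}rd : r = d by lia.
  subst r; rewrite -[gen_value _ _]/(twisted l h d.+1 i j).
  rewrite (twisted_perturb (twisted_rec f0) (twisted_rec h0) hf f0 (ltn0Sn d) hd).
  have subE (M M' M'' : 'M[K]_n) : (M + (M' - M'')) i j = M i j + (M' i j - M'' i j).
    by rewrite !mxE.
  rewrite subE mulmx_sign mul_sign_mx mul_sign mulrA -exprD.
  have -> : (-1) ^+ ((n - l <= i) + d.+1) = - (-1) ^+ (n - l <= j)%N :> K.
    rewrite -signr_odd oddD oddb -signrN; congr (_ ^+ nat_of_bool _); move: good.
    rewrite -[good_letter _ _]/(((n - l <= i)%N (+) (n - l <= j)%N) (+) odd d.+1).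
    by move: (n - l <= i)%N (n - l <= j)%N (odd d.+1) => [] [] [].
  have DE : D i j = (y (d, i, j) - twisted l f d.+1 i j) / (2%:R * eps j) by rewrite mxE.
  rewrite mulNr opprK -/(eps j) DE [eps j * _]mulrC -mulrDl -mulr2n -(mulr_natr (_ / _)) -(mulrA (_ / _)).
  have eps0 : 2%:R * eps j != 0 by rewrite mulf_neq0 ?pnatr_eq0 ?signr_eq0.
  by rewrite divfK // addrC subrK.
rewrite -[gen_value _ _]/(twisted l h r.+1 i j) (twisted_agree (twisted_rec f0) (twisted_rec h0) hf) //.
exact: (fy (r, i, j)).
Qed.

End RealizeLetters.

(** * Polynomial identities from vanishing at all points *)

Section BaseExpansion.
Variable N : nat.
Implicit Types u v : seq nat.

(** When u has fewer than N entries, its multiplicities are the base-N digits of this number, which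
    therefore determines u up to order. *)
Definition digits_value u := (\sum_(k <- u) N ^ k)%N.
Definition drop_digit u := [seq k.-1 | k <- u & k != 0%N].

Lemma digits_value_drop u :
  digits_value u = (count_mem 0 u + N * digits_value (drop_digit u))%N.
Proof.
rewrite /digits_value; elim: u => [|k u IHu]; first by rewrite /= !big_nil muln0.
rewrite big_cons IHu /drop_digit /=; case: k => [|k] /=.
  by rewrite expn0 addnA.
by rewrite big_cons mulnDr -expnS addnCA.
Qed.

Lemma count_drop_digit u k : count_mem k (drop_digit u) = count_mem k.+1 u.
Proof. by elim: u => [//|[|j] u IHu] //=; rewrite IHu. Qed.

Lemma digits_value_inj u v : (size u < N)%N -> (size v < N)%N ->
  digits_value u = digits_value v -> perm_eq u v.
Proof.
move=> uN vN uv; apply/allP => k _; apply/eqP.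
have szN w : (size w < N)%N -> (size (drop_digit w) < N)%N.
  by apply: leq_ltn_trans; rewrite size_map size_filter count_size.
have count0 w : (size w < N)%N -> count_mem 0%N w = (digits_value w %% N)%N.
  move=> wN; rewrite digits_value_drop addnC mulnC modnMDl modn_small //.
  by apply: leq_ltn_trans wN; apply: count_size.
elim: k u v uN vN uv => [|k IHk] u v uN vN uv; first by rewrite /= !count0 ?uv.
rewrite /= -!count_drop_digit; apply: IHk; try exact: szN.
have N0 : (0 < N)%N by apply: leq_ltn_trans uN.
have := uv; rewrite (digits_value_drop u) (digits_value_drop v) !count0 // uv.
by move/addnI/eqP; rewrite eqn_pmul2l // => /eqP.
Qed.

End BaseExpansion.

Lemma poly_vanish (K : numFieldType) (p : {poly K}) : (forall t, p.[t] = 0) -> p = 0.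
Proof.
move=> p0; apply/eqP; apply/negP => /negP pn0.
pose rs : seq K := [seq i%:R | i <- iota 0 (size p)].
have := @max_poly_roots _ p rs pn0; rewrite size_map size_iota ltnn => H.
suff: false by []. apply: H; first by apply/allP => x _; rewrite rootE p0.
by rewrite map_inj_uniq ?iota_uniq // => i j /eqP; rewrite eqr_nat => /eqP.
Qed.

(** Kronecker substitution: with y_g = t^(N^pickle g) a monomial becomes a power of t. If N exceeds
    all word lengths, distinct multisets of letters give distinct exponents, and a polynomial in t
    vanishing at every point of an infinite field is zero. *)
Lemma monomial_coefficient (K : numFieldType) (L : countType) (s : seq (K * seq L)) w0 :
  (forall y : L -> K, \sum_(cw <- s) cw.1 * \prod_(g <- cw.2) y g = 0) ->
  \sum_(cw <- s | perm_eq cw.2 w0) cw.1 = 0.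
Proof.
move=> s0; pose N := (\max_(cw <- (0, w0) :: s) size cw.2).+1.
pose code (w : seq L) := digits_value N [seq pickle g | g <- w].
have codeE (cw : K * seq L) : cw \in s -> (code cw.2 == code w0) = perm_eq cw.2 w0.
  move=> cws; apply/eqP/idP => [/digits_value_inj|cw0]; last first.
    by rewrite /code /digits_value; apply: perm_big; apply: perm_map.
  rewrite !size_map => H; apply/(perm_map_inj (@pcan_inj _ _ _ _ (@pickleK L)))/H.
    rewrite ltnS; apply: (leq_bigmax_seq (F := fun cw : K * seq L => size cw.2) cw) => //.
    by rewrite in_cons cws orbT.
  rewrite ltnS; exact: (leq_bigmax_seq (F := fun cw : K * seq L => size cw.2) (0, w0) (mem_head _ _)).
pose p : {poly K} := \sum_(cw <- s) cw.1 *: 'X^(code cw.2).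
have p0 : p = 0.
  apply: poly_vanish => t; rewrite -[RHS](s0 (fun g => t ^+ (N ^ pickle g))).
  rewrite horner_sum; apply: eq_bigr => cw _; rewrite hornerZ hornerXn.
  by rewrite -expr_sum /code /digits_value big_map.
have := congr1 (fun q : {poly K} => q`_(code w0)) p0.
rewrite coef0 coef_sum => H; rewrite -[RHS]H big_mkcond big_seq [RHS]big_seq.
apply: eq_bigr => cw /codeE <-; rewrite coefZ coefXn eq_sym.
by case: eqP => _; rewrite ?mulr1 ?mulr0.
Qed.

(** Words that are permutations of each other agree modulo lower weight, so cancellation between
    commutative monomials lifts to the algebra. The induction removes one permutation class at a
    time, that of the first word. *)
Lemma vanishing_comb_below (K : numFieldType) (A : algType K) (L : countType) (b : L -> A)
    (wt : L -> nat) d (s : seq (K * seq L)) :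
  (forall g h, word_span b (below wt (wt g + wt h)) (b g * b h - b h * b g)) ->
  all (fun cw => weight wt cw.2 == d) s ->
  (forall y : L -> K, \sum_(cw <- s) cw.1 * \prod_(g <- cw.2) y g = 0) ->
  word_span b (below wt d) (word_comb b s).
Proof.
move=> comm; have [m] := ubnP (size s); elim: m s => // m IHm [|[c0 w0] s'].
  by move=> *; rewrite /word_comb big_nil; apply: word_span0.
set s := _ :: s' => sm sd s0; pose P (cw : K * seq L) := perm_eq cw.2 w0.
have c0s := monomial_coefficient w0 s0.
rewrite /word_comb (bigID P) /=; apply: word_spanD.
  (* The coefficients of this class sum to 0, so the same representative can be subtracted from
     every word, leaving differences of permuted words. *)
  have -> : \sum_(cw <- s | P cw) cw.1 *: word b cw.2
      = \sum_(cw <- s | P cw) cw.1 *: (word b cw.2 - word b w0).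
    under [RHS]eq_bigr do rewrite scalerBr.
    by rewrite sumrB -scaler_suml c0s scale0r subr0.
  rewrite big_seq_cond; apply: word_span_sum => cw /andP[cws Pcw]; apply: word_spanZ.
  by rewrite -(eqP (allP sd cw cws)); apply: word_perm.
rewrite -big_filter; apply: IHm.
- rewrite size_filter /= /P perm_refl add0n.
  by apply: leq_ltn_trans (count_size _ _) _; move: sm; rewrite /s /=.
- by rewrite all_filter; apply: sub_all sd => cw cwd; apply/implyP.
move=> y; rewrite big_filter; have := s0 y; rewrite (bigID P) /=.
have -> : \sum_(cw <- s | P cw) cw.1 * \prod_(g <- cw.2) y g
    = \sum_(cw <- s | P cw) cw.1 * \prod_(g <- w0) y g.
  by apply: eq_bigr => cw Pcw; rewrite (perm_big _ Pcw).
by rewrite -mulr_suml c0s mul0r add0r.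
Qed.

(** * The kernel is zero, by descent on the weight *)

Section Injectivity.
Variables (K : numClosedFieldType) (n l : nat).
Variable phi : {lrmorphism reflection_algebra K n l -> yangian K n}.
Hypothesis phiB : fps_map (map_mx phi) (reflection_B K n l) = twisted l (yangian_T K n).
Local Notation b := (gen_value (reflection_B K n l)).
Local Notation wt := (@order n).

Lemma order_le_weight (w : seq (letter n)) g : g \in w -> (order g <= weight wt w)%N.
Proof. by move=> gw; rewrite /weight (big_rem g) //= leq_addr. Qed.

Lemma kernel_below d x : word_span b (below wt d) x -> phi x = 0 -> x = 0.
Proof.
elim: d x => [|d IHd] x.
  by case=> [[|cw s] //= _ ->] _; rewrite /word_comb big_nil.
move=> Vx phix; apply: IHd => //.
(* Redundant letters are removed first, because only the values at the remaining ones can be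
   prescribed independently. *)
have [s sd xs] : word_span b (good_upto l d) x.
  apply: word_span_trans Vx _ => w; rewrite /below ltnS => wd.
  have := good_span_word (reflection_B0 K n l) (reflection_B_unitarity K n l) w.
  move=> Vw; apply: word_span_sub Vw _ => w'; rewrite !unfold_in => /andP[-> ww'].
  exact: leq_trans ww' wd.
pose top (cw : K * seq (letter n)) := weight wt cw.2 == d.
have -> : x = word_comb b (filter top s) + word_comb b (filter (predC top) s).
  by rewrite xs /word_comb (bigID top) !big_filter.
apply: word_spanD; last first.
  exists (filter (predC top) s) => //; rewrite all_filter.
  apply: sub_all sd => cw /andP[_ cwd]; apply/implyP => ncw.
  by rewrite /below ltn_neqAle cwd andbT.
apply: vanishing_comb_below.
- exact: commutator_below (reflection_B0 K n l) (reflection_B_eqn K n l).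
- exact: filter_all.
(* A letter in a word of weight d has order at most d, so a point prescribed only up to order d
   realizes every value that occurs. *)
move=> y; have [f [[M [N fMN]] fy]] := realize_letters l d y.
have sd' : all (fun cw => weight wt cw.2 <= d)%N s.
  by apply: sub_all sd => cw /andP[].
rewrite xs in phix; have := top_part_vanishes M N phiB sd' phix.
rewrite big_filter -fMN => H; rewrite -[RHS]H big_seq_cond [RHS]big_seq_cond.
apply: eq_bigr => cw /andP[cws /eqP cwd]; congr (_ * _).
have /andP[good _] := allP sd cw cws.
rewrite big_seq [RHS]big_seq; apply: eq_bigr => g gw; rewrite fy //.
  exact: (allP good).
by rewrite -cwd; apply: order_le_weight.
Qed.

Lemma reflection_span (x : reflection_algebra K n l) : exists d, word_span b (below wt d) x.
Proof.
have [s sE] := freeAlg_span (repr (x : Quotient.quot (ideal_pred (@reflection_rels K n l)))).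
exists (\max_(cw <- s) weight wt cw.2).+1; exists s.
  apply/allP => cw cws; rewrite /below ltnS.
  exact: (leq_bigmax_seq (F := fun cw : K * seq (letter n) => weight wt cw.2) cw).
have -> : x = quotAlg_pi (@reflection_proper K n l)
    (\sum_(cw <- s) cw.1 *: \prod_(a <- cw.2) freeAlg_gen K a).
  by rewrite -sE; apply: esym; apply: quotAlg_repr.
rewrite linear_sum; apply: eq_bigr => cw _; rewrite linearZ rmorph_prod.
congr (_ *: _); apply: eq_bigr => -[[r i] j] _.
by rewrite /gen_value mxE /= mxE.
Qed.

Lemma reflection_to_yangian_injective : injective phi.
Proof.
move=> x y /eqP; rewrite -subr_eq0 -raddfB => /eqP phixy.
by have [d /kernel_below/(_ phixy)/eqP] := reflection_span (x - y); rewrite subr_eq0 => /eqP.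
Qed.

End Injectivity.

Theorem theorem3p1 (R : realType) (n k l : nat)
    (hn : n = (k + l)%N) (hl : (2 * l <= n)%N) :
  exists phi : {lrmorphism reflection_algebra R[i] n l -> yangian R[i] n},
    fps_map (map_mx phi) (reflection_B R[i] n l)
      = yangian_T R[i] n * fps_const (sign_mx (yangian R[i] n) n l)
          * fps_neg (fps_inv (yangian_T R[i] n))
    /\ injective phi.
Proof.
have [phi phiB] := reflection_to_yangian R[i] n l.
by exists phi; split; [apply: phiB | apply: reflection_to_yangian_injective phiB].
Qed.
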